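(* Let $E$ be a uniquely ergodic interval exchange transformation which is renormalizable with scaling ratio $\rho$, and let $R$ be the matrix of multiplication by $\rho$ on $\mathbf{L}$. There exists a positive constant $C$ (independent of $x$, $t$, $T$) such that, for every point $x$ whose Vershik code is eventually periodic with transient $t$ and period $T$, the point $z=\phi(x)$ satisfies $$\|z\|\le C\,\|R\|^{t+T},$$ where $\|R\|$ is the induced norm of matrices.
   Context: $E$ is an interval exchange transformation of $\Omega=[0,1)$ on $N\ge2$ consecutive half-open intervals $\Omega_1,\dots,\Omega_N$ (irreducible permutation), $E(x)=x+\tau_i$ on $\Omega_i$. The lengths $|\Omega_i|$ generate a number field $K$ of degree $n$, and the module $\mathcal{M}=\{\sum_i m_i|\Omega_i|:m_i\in\mathbb{Z}\}$ has (maximal) rank $n$. Fix a $\mathbb{Z}$-basis of $\mathcal{M}$, let $\phi:\mathcal{M}\to\mathbf{L}=\mathbb{Z}^n$ be the coordinate isomorphism, and extend it $\mathbb{Q}$-linearly to $\phi:K\to\mathbb{Q}^n$. Renormalizable with scaling ratio $\rho\in(0,1)$: the first-return map of $E$ on $I=[0,\rho)$ is $x\mapsto\rho E(x/\rho)$, an interval exchange on the intervals $\rho\Omega_i$. The substitution $\sigma$ on $\{1,\dots,N\}$ associates to $i$ the word of indices of the $\Omega_j$ successively visited by the $E$-orbit of the points of $\rho\Omega_i$, from time $0$ up to (not including) the first return to $I$; so $E^{|\sigma(i)|}(\rho x)=\rho E(x)$ for $x\in\Omega_i$. One has $\rho\mathcal{M}\subset\mathcal{M}$, and $R$ is the integer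 matrix with $R\phi(x)=\phi(\rho x)$. Vershik code: $\mathcal{P}$ is the set of pairs ($i$, proper prefix $\mu$ of $\sigma(i)$), the empty prefix included; for such a $\mu$ put $\chi(\mu)=i$, and let $|\mu|$ be its length. The interval $\Omega$ is the disjoint union of the sets $E^{|\mu|}(\rho\Omega_{\chi(\mu)})$, $\mu\in\mathcal{P}$ (recursive tiling). Hence for each $x\in\Omega$ there are a unique $\mu_1\in\mathcal{P}$ and a unique $x'\in\Omega_{\chi(\mu_1)}$ with $x=E^{|\mu_1|}(\rho x')$; repeating this with $x'$ in place of $x$, and so on, defines the Vershik code $(\mu_1,\mu_2,\dots)\in\mathcal{P}^{\mathbb{N}}$ of $x$. It is eventually periodic with transient $t\ge0$ and period $T\ge1$ if it has the form $\mu_1\cdots\mu_t(\mu_{t+1}\cdots\mu_{t+T})^\infty$. Every point with eventually periodic Vershik code lies in $K$. $\|\cdot\|$ is a fixed norm on $\mathbb{R}^n$, and also the induced operator norm on matrices. *)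

(* Defs.v *)
From HB Require Import structures.
From mathcomp Require Import all_boot all_order all_algebra all_fingroup all_field.
From mathcomp Require Import all_classical all_reals all_analysis.

Set Implicit Arguments.
Unset Strict Implicit.
Unset Printing Implicit Defensive.

Import Order.TTheory GRing.Theory Num.Theory.

Local Open Scope classical_set_scope.
Local Open Scope ring_scope.

(* Interval exchanges of [0, 1).  Intervals are indexed from 0, and            *)
(* [iet_perm E i] is the position of the [i]-th interval after the exchange.   *)

Record iet (R : realType) (N : nat) := Iet {
  iet_len : 'I_N -> R ;
  iet_perm : 'S_N ;
  iet_len_gt0 : forall i, 0 < iet_len i ;
  iet_len_sum : \sum_i iet_len i = 1
}.

Definition iet_irreducible (R : realType) (N : nat) (E : iet R N) : Prop :=
  forall k : nat, (0 < k < N)%N ->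
    iet_perm E @: [set i : 'I_N | (i < k)%N]%SET
      != [set i : 'I_N | (i < k)%N]%SET.

Definition iet_left (R : realType) (N : nat) (E : iet R N) (i : 'I_N) : R :=
  \sum_(j < N | (j < i)%N) iet_len E j.

Definition in_piece (R : realType) (N : nat) (E : iet R N) (i : 'I_N) (x : R)
    : bool :=
  iet_left E i <= x < iet_left E i + iet_len E i.

Definition iet_trans (R : realType) (N : nat) (E : iet R N) (i : 'I_N) : R :=
  \sum_(j < N | (iet_perm E j < iet_perm E i)%N) iet_len E j - iet_left E i.

(* Extended by the identity outside [0, 1). *)
Definition iet_map (R : realType) (N : nat) (E : iet R N) (x : R) : R :=
  if [pick i | in_piece E i x] is Some i then x + iet_trans E i else x.

(* Borel probability measures on [0, 1) are represented by the Borel           *)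
(* probability measures on the line which give full mass to [0, 1).            *)
Definition iet_invariant (R : realType) (N : nat) (E : iet R N)
    (P : probability (measurableTypeR R) R) : Prop :=
  P `[0, 1[%classic = 1%E /\
  forall A : set (measurableTypeR R), measurable A ->
    P (iet_map E @^-1` A) = P A.

Definition uniquely_ergodic (R : realType) (N : nat) (E : iet R N) : Prop :=
  exists P : probability (measurableTypeR R) R, iet_invariant E P /\
  forall Q : probability (measurableTypeR R) R, iet_invariant E Q ->
    forall A : set (measurableTypeR R), measurable A -> Q A = P A.

(* [r] is the time of first return to [A] of the [f]-orbit of [x]. *)
Definition first_return_time (T : Type) (f : T -> T) (A : set T) (x : T)
    (r : nat) : Prop :=
  [/\ (0 < r)%N, A (iter r f x) &
      forall k : nat, (0 < k < r)%N -> ~ A (iter k f x)].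

Definition renormalizable (R : realType) (N : nat) (E : iet R N) (rho : R)
    : Prop :=
  0 < rho < 1 /\
  forall x : R, 0 <= x < rho ->
    exists2 r : nat,
      first_return_time (iet_map E) `[0, rho[%classic x r &
      iter r (iet_map E) x = rho * iet_map E (x / rho).

(* [sigma i] is the common itinerary, up to the first return to [0, rho), of   *)
(* all the points of the interval [rho Omega_i].                               *)
Definition is_substitution (R : realType) (N : nat) (E : iet R N) (rho : R)
    (sigma : 'I_N -> seq 'I_N) : Prop :=
  forall (i : 'I_N) (x : R), in_piece E i x ->
    first_return_time (iet_map E) `[0, rho[%classic (rho * x)
      (size (sigma i)) /\
    forall k : nat, (k < size (sigma i))%N ->
      in_piece E (nth i (sigma i) k) (iter k (iet_map E) (rho * x)).

(* A letter (i, mu) of the Vershik alphabet: [chi] is the first component. *)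
Definition vershik_letter (N : nat) (sigma : 'I_N -> seq 'I_N)
    (p : 'I_N * seq 'I_N) : bool :=
  prefix p.2 (sigma p.1) && (p.2 != sigma p.1).

(* [y] is the sequence x, x', x'', ... of points produced along the code. *)
Definition vershik_code (R : realType) (N : nat) (E : iet R N) (rho : R)
    (sigma : 'I_N -> seq 'I_N) (x : R) (c : nat -> 'I_N * seq 'I_N) : Prop :=
  exists2 y : nat -> R, y 0%N = x &
    forall k : nat,
      [/\ vershik_letter sigma (c k), in_piece E (c k).1 (y k.+1) &
          y k = iter (size (c k).2) (iet_map E) (rho * y k.+1)].

(* Neither [t] nor [T] is required to be minimal. *)
Definition eventually_periodic (A : Type) (c : nat -> A) (t T : nat) : Prop :=
  (0 < T)%N /\ forall k : nat, (t <= k)%N -> c (k + T)%N = c k.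

Definition is_Zbasis (V : zmodType) (N n : nat) (s : N.-tuple V)
    (b : n.-tuple V) : Prop :=
  (forall v : V, inIntSpan s v <-> inIntSpan b v) /\
  (forall m : 'I_n -> int,
     \sum_(i < n) b`_i *~ m i = 0 -> forall i, m i = 0).

Definition phi (K : fieldExtType rat) (n : nat) (b : n.-tuple K) (x : K)
    : 'cV[rat]_n :=
  \col_i coord b i x.

(* [A] is the matrix, in the basis [b], of multiplication by the real number   *)
(* [rho] on the module spanned by [s], with [K] embedded in [R] by [iota].     *)
Definition is_mult_matrix (R : realType) (K : fieldExtType rat)
    (iota : {rmorphism K -> R}) (N n : nat) (s : N.-tuple K) (b : n.-tuple K)
    (rho : R) (A : 'M[int]_n) : Prop :=
  forall x : K, inIntSpan s x ->
    exists2 y : K, iota y = rho * iota x &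
      map_mx intr A *m phi b x = phi b y.

Definition is_vnorm (R : realType) (n : nat) (nrm : 'cV[R]_n -> R) : Prop :=
  [/\ forall u v, nrm (u + v) <= nrm u + nrm v,
      forall (a : R) u, nrm (a *: u) = `|a| * nrm u &
      forall u, nrm u = 0 -> u = 0].

Definition op_norm (R : realType) (n : nat) (nrm : 'cV[R]_n -> R)
    (A : 'M[R]_n) : R :=
  sup [set nrm (A *m u) | u in [set u : 'cV[R]_n | nrm u <= 1]].

(* Main.v *)
Require Import Defs.
From HB Require Import structures.
From mathcomp Require Import all_boot all_order all_algebra all_fingroup all_field.
From mathcomp Require Import all_classical all_reals all_analysis.
From mathcomp Require Import complex.
From mathcomp Require Import ring lra zify.

Import Order.TTheory GRing.Theory Num.Theory.
Import numFieldNormedType.Exports.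
Local Open Scope ring_scope.

(* A point y whose code has period T satisfies y = s + rho^T y, where *)
(* s = \sum_(j < T) rho^j d_j has digits d_j taken from a finite set, so that *)
(* phi y = (1 - R^T)^-1 \sum_(j < T) R^j phi(d_j).  The transient adds t *)
(* digits and a factor ||R||^t, which is harmless because ||R|| > 1: *)
(* otherwise the integer matrices R^j would be bounded, hence would repeat. *)
(* As Q[R] is a field, R is diagonalizable over the complex numbers, and on *)
(* each eigenline, with eigenvalue lam, one needs *)
(*   \sum_(j < T) |lam|^j <= C ||R||^T |1 - lam^T|. *)
(* This is immediate if |lam| <> 1.  But rho may have conjugates on the unit *)
(* circle, for which the norm of 1 - lam^T alone gives too weak a bound; for *)
(* them we prove, in the manner of Gelfond, that |lam^T - 1| >= T / (C Lam^T) *)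
(* for every Lam > 1.  If lam^T is too close to 1, then lam is close to om^k *)
(* with om = e^(2 pi i / T).  The pigeonhole principle provides a non-zero *)
(* integer polynomial P of small size with P(M, om^M) tiny at all integers *)
(* 0 <= M <= T B.  At M = k r + s T one has om^M = (om^k)^r, which is close *)
(* to lam^r, so the algebraic integers P(k r + s T, lam^r) are too small to *)
(* be non-zero, and a zero estimate then gives P = 0. *)

(** * A zero estimate for polynomials in [X] and [lam ^ X] *)

(** One step of the Vershik code reads [x = rho x' + delta], where [delta] is the total translation
    along the prefix ([iter_digit]); there are finitely many prefixes, so the vectors [phi(delta)]
    have bounded norm. By [contraction_fixed] two points with the same code coincide, so the tail of
    an eventually periodic code is the code of a solution of [y = s + rho^T y], and [phi] turns
    multiplication by [rho] into [R]. The core is [periodic_point_bound]. After the diagonalization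
    of [rational_mx_diagonalizable], each eigencoordinate of [y] is, up to a constant, at most
    [\sum_(j < T) |lam|^j / |1 - lam^T|], and [sum_exp_le] bounds this quotient by a multiple of
    [||R||^T]. The case [|lam| = 1] is [unit_circle_lower_bound]; there the sum is [T]. The
    arithmetic input is Liouville's inequality ([eigenvalue_liouville]): for an integer polynomial
    [q], the determinant of [q(R)] is an integer, the product of the values of [q] at the
    eigenvalues, and it is non-zero unless [q(R) = 0], because [q(R)] represents multiplication by
    an element of the field [K] ([mult_matrix_field]). Applied to [lam^T - 1] alone it gives a bound
    with a fixed exponential rate, whereas every rate [Lam > 1] is needed. The improvement comes
    from [auxiliary_polynomial], whose values [no_close_root] shows to vanish at too many points,
    against [zero_estimate]. *)

Lemma eventually_nonroot (F : numFieldType) (h : F) (g : {poly F}) :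
  h != 0 -> g != 0 ->
  exists N : nat, forall j : nat, (N <= j)%N -> g.[j%:R * h] != 0.
Proof.
move=> h0; have [n] := ubnP (size g); elim: n g => // n IHn g szg g0.
have [[j0 gj0]|nroot] := EM (exists j : nat, g.[j%:R * h] = 0); last first.
  by exists 0%N => j _; apply/eqP => gj; apply: nroot; exists j.
have /factor_theorem[q gE] : root g (j0%:R * h) by apply/eqP.
have q0 : q != 0 by apply: contraNneq g0 => q0; rewrite gE q0 mul0r.
have szq : (size q < n)%N.
  by move: szg; rewrite gE size_Mmonic ?monicXsubC// size_XsubC addn2.
have [N Nq] := IHn q szq q0.
exists (maxn N j0.+1) => j; rewrite geq_max => /andP[Nj j0j].
rewrite gE hornerM mulf_neq0 ?Nq// !hornerE -mulrBl mulf_neq0//.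
by rewrite subr_eq0 eqr_nat gtn_eqF.
Qed.

(* The quotient [f / g] is invariant under translation by [h], so it is *)
(* constant along an arithmetic progression. *)
Lemma shift_proportional (F : numFieldType) (h : F) (f g : {poly F}) :
  h != 0 -> g != 0 ->
  f * (g \Po ('X + h%:P)) = g * (f \Po ('X + h%:P)) ->
  exists a : F, f = a *: g.
Proof.
move=> h0 g0 fgE; have [N gN] := eventually_nonroot _ _ _ h0 g0.
pose x j := (N + j)%:R * h; pose a := f.[x 0%N] / g.[x 0%N].
have gx j : g.[x j] != 0 by rewrite gN// leq_addr.
have fx j : f.[x j] = a * g.[x j].
  elim: j => [|j IHj]; first by rewrite /a divfK.
  have := congr1 (horner^~ (x j)) fgE; rewrite !hornerM !horner_comp !hornerE IHj.
  have -> : x j + h = x j.+1 by rewrite /x addnS -natr1 mulrDl mul1r.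
  by rewrite mulrAC [g.[_] * f.[_]]mulrC => /mulIf ->.
exists a; apply/eqP; rewrite -subr_eq0; apply: contraTT isT => fg0.
have [M fgM] := eventually_nonroot _ _ _ h0 fg0.
have := fgM (N + M)%N (leq_addl _ _).
by rewrite -[_ * h]/(x M) !hornerE fx subrr eqxx.
Qed.

Definition casorati (F : fieldType) (h : F) (d : nat) (b : nat -> {poly F}) :
    'M[{poly F}]_d :=
  \matrix_(s < d, j < d) (b j \Po ('X + (s%:R * h)%:P)).

(** The Casorati determinant is the discrete Wronskian. If it vanished, the cofactors [c_j] of the
    last row would be orthogonal to all rows, and their translates [c_j(X + h)] to rows 1 to [d].
    Eliminating the last column between these two relations gives a vector killed by a translate of
    the Casorati matrix of size [d], which is non-singular by induction. Hence all ratios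
    [c_j / c_max] are invariant under [h], thus constant, and row 0 becomes a linear relation
    between the [b_j]. *)
Lemma casorati_det_neq0 (F : numFieldType) (h : F) (d : nat)
    (b : nat -> {poly F}) :
  h != 0 ->
  (forall a : nat -> F, \sum_(j < d) a j *: b j = 0 ->
     forall j, (j < d)%N -> a j = 0) ->
  \det (casorati F h d b) != 0.
Proof.
move=> h0; elim: d => [|d IHd] bfree; first by rewrite det_mx00 oner_eq0.
have {IHd} minor0 : \det (casorati F h d b) != 0.
  apply: IHd => a a0 j jd.
  have := bfree (fun j => if (j < d)%N then a j else 0).
  rewrite big_ord_recr/= ltnn scale0r addr0.
  under eq_bigr do rewrite ltn_ord.
  by move=> /(_ a0 j (ltnW jd)); rewrite jd.
pose M := casorati F h d.+1 b; apply/negP => /eqP detM0.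
pose c j := cofactor M ord_max j.
have cmax : c ord_max = \det (casorati F h d b).
  rewrite /c /cofactor -signr_odd addnn odd_double mul1r; congr (\det _).
  by apply/matrixP => i j; rewrite !mxE !lift_max.
have Mc s : \sum_j M s j * c j = 0.
  have : (M *m \adj M) s ord_max = 0.
    by rewrite mul_mx_adj [\det M]detM0 [LHS]mxE mul0rn.
  rewrite [LHS]mxE; apply: etrans; apply: eq_bigr => j _.
  by rewrite [(\adj M) _ _]mxE.
pose sh := 'X + h%:P : {poly F}.
have shS (p : {poly F}) (s : nat) :
    (p \Po ('X + (s%:R * h)%:P)) \Po sh = p \Po ('X + (s.+1%:R * h)%:P).
  rewrite -comp_polyA; congr (_ \Po _).
  by rewrite comp_polyD comp_polyX comp_polyC -addrA -polyCD -natr1 mulrDl mul1r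
    [_ + h]addrC.
have Mcsh (s : nat) : (s < d)%N ->
    \sum_(j < d.+1) (b j \Po ('X + (s.+1%:R * h)%:P)) * (c j \Po sh) = 0.
  move=> sd; have sd1 : (s < d.+1)%N by rewrite ltnW.
  have := congr1 (fun p => p \Po sh) (Mc (Ordinal sd1)).
  rewrite comp_poly0 rmorph_sum/=; apply: etrans.
  by apply: eq_bigr => j _; rewrite [RHS]comp_polyM mxE/= shS.
(* The combination of [c] and its translate whose last coordinate is zero. *)
pose v (j : 'I_d) := c (widen_ord (leqnSn d) j) * (c ord_max \Po sh)
   - c ord_max * (c (widen_ord (leqnSn d) j) \Po sh).
have v0 j : v j = 0.
  pose vr : 'rV_d := \row_j v j.
  suff /rowP/(_ j) : vr = 0 by rewrite !mxE.
  apply/eqP; apply: contraTT minor0 => vr0; rewrite negbK.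
  have shdet : \det (map_mx (comp_poly sh) (casorati F h d b)) == 0.
    rewrite -det_tr; apply/det0P; exists vr => //.
    apply/rowP => s; rewrite !mxE.
    have sd : (s.+1 < d.+1)%N by rewrite ltnS.
    have E1 := Mc (Ordinal sd); have E2 := Mcsh s (ltn_ord s).
    rewrite big_ord_recr/= in E1; rewrite big_ord_recr/= in E2.
    transitivity ((c ord_max \Po sh) * (\sum_(j < d.+1) M (Ordinal sd) j * c j)
       - c ord_max *
        (\sum_(j < d.+1) (b j \Po ('X + (s.+1%:R * h)%:P)) * (c j \Po sh))).
      rewrite !big_ord_recr/= !mxE/= !mulrDr opprD addrACA !mulr_sumr -sumrB.
      rewrite [X in _ + X](_ : _ = 0) ?addr0.
        by apply: eq_bigr => i _; rewrite !mxE/= shS /v; ring.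
      by apply/eqP; rewrite subr_eq0; apply/eqP; ring.
    by rewrite Mc Mcsh// !mulr0 subrr.
  move: shdet; rewrite (det_map_mx (comp_poly sh)).
  rewrite comp_poly_eq0// /sh size_XaddC//.
have minor0' := minor0; rewrite -cmax in minor0'.
have /choice[a aE] : forall j : 'I_d.+1, exists a : F, c j = a *: c ord_max.
  move=> j; have [jd|] := ltnP j d.
    have := v0 (Ordinal jd); rewrite /v.
    rewrite (_ : widen_ord _ _ = j); last exact/val_inj.
    by move=> /eqP; rewrite subr_eq0 => /eqP; apply: shift_proportional.
  move=> dj; exists 1; rewrite scale1r; congr c; apply/val_inj/eqP => /=.
  by rewrite eqn_leq dj -ltnS ltn_ord.
have a1 : a ord_max = 1.
  have := aE ord_max; rewrite -{1}[c _]scale1r => /eqP.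
  by rewrite -subr_eq0 -scalerBl scaler_eq0 (negPf minor0') orbF subr_eq0 => /eqP.
have := bfree (fun j => if insub j is Some i then a i else 0).
have : \sum_(j < d.+1) a j *: b j = 0.
  have := Mc ord0; under eq_bigr do
    rewrite mxE mul0r addr0 comp_polyXr aE -scalerAr scalerAl.
  by rewrite -mulr_suml => /eqP; rewrite mulf_eq0 (negPf minor0') orbF => /eqP.
move=> sum0 /(_ _ d (ltnSn d)); case: insubP => [i _ iE|]; last by rewrite ltnSn.
rewrite (_ : i = ord_max) ?a1; last exact/val_inj.
move=> H; move/eqP: (oner_neq0 F); apply; apply: H.
by rewrite -[RHS]sum0; apply: eq_bigr => j _; rewrite valK.
Qed.

Lemma size_det_leq (F : fieldType) (d m : nat) (M : 'M[{poly F}]_d) :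
  (forall i j, (size (M i j) <= m)%N) -> (size (\det M) <= (d * m).+1)%N.
Proof.
move=> Mm; apply: (leq_trans (size_sum _ _ _)); apply/bigmax_leqP => s _.
rewrite -signr_odd; apply: (@leq_trans (size (\prod_i M i (s i)))).
  by case: (odd _); rewrite ?expr1 ?expr0 ?mulN1r ?mul1r ?size_polyN.
apply: (leq_trans (size_prod_leq _ _)).
rewrite (leq_trans (leq_subr _ _))// ltnS.
rewrite -[X in (X * _)%N]card_ord -sum_nat_const.
by apply: leq_sum => i _.
Qed.

Definition falling_poly (F : fieldType) (i : nat) : {poly F} :=
  \prod_(c < i) ('X - (c%:R)%:P).

Lemma falling_poly_nat (F : fieldType) (i m : nat) :
  (falling_poly F i).[m%:R] = (m ^_ i)%:R.
Proof.
elim: i => [|i IHi]; first by rewrite /falling_poly big_ord0 hornerC.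
rewrite /falling_poly big_ord_recr/= hornerM [_.[_]]IHi !hornerE ffactnSr natrM.
have [im|mi] := leqP i m; first by rewrite natrB.
by rewrite ffact_small// !mul0r.
Qed.

(** Evaluation at [0, 1, 2, ...] gives a triangular system with diagonal entries [i!]. *)
Lemma falling_poly_free (F : numFieldType) (n : nat) (v : 'I_n -> F) :
  \sum_i v i *: falling_poly F i = 0 -> forall i, v i = 0.
Proof.
move=> v0 i; have [m] := ubnP i; elim: m i => // m IHm i im.
have := congr1 (horner^~ (i%:R : F)) v0; rewrite horner_sum horner0.
rewrite (bigD1 i)//= big1 ?addr0 => [|j ji].
  rewrite hornerZ falling_poly_nat ffactnn => /eqP.
  by rewrite mulf_eq0 pnatr_eq0 -[_ == 0%N]negbK -lt0n fact_gt0 orbF => /eqP.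
rewrite hornerZ falling_poly_nat.
have [ij|] := ltnP i j; first by rewrite ffact_small// mulr0.
rewrite leq_eqVlt => /predU1P[/val_inj/eqP|ji']; first by rewrite (negPf ji).
by rewrite IHm ?mul0r// (leq_trans ji').
Qed.

Lemma size_falling_poly (F : fieldType) (i : nat) :
  size (falling_poly F i) = i.+1.
Proof.
rewrite /falling_poly -(big_mkord xpredT (fun c => 'X - (c%:R)%:P)).
by rewrite size_prod_XsubC size_iota subn0.
Qed.

(* Writing [p] as a product of two matrices of full rank [d <= L] gives *)
(* polynomials [b_j(X)] such that the Casorati determinant of the [b_j] *)
(* vanishes at the points [k r + s T]. *)
Lemma zero_estimate (F : numFieldType) (I L S R0 T k : nat) (lam : F)
    (p : 'M[F]_(I, L)) :
  (0 < T)%N ->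
  (forall r r', (r < R0)%N -> (r' < R0)%N -> lam ^+ r = lam ^+ r' -> r = r') ->
  (forall r r', (r < R0)%N -> (r' < R0)%N ->
     k * r = k * r' %[mod T] -> r = r')%N ->
  (L * I < (R0 - L) * (S - L))%N ->
  (forall r s, (r < R0)%N -> (s < S)%N ->
     \sum_i \sum_l p i l * ((k * r + s * T) ^_ i)%:R * lam ^+ (l * r) = 0) ->
  p = 0.
Proof.
move=> T0 laminj kinj LIRS vanish; apply/eqP; apply: contraTT isT => p0.
pose d := \rank p; have d0 : (0 < d)%N by rewrite lt0n mxrank_eq0.
have dL : (d <= L)%N by apply: rank_leq_col.
have [B [Q [pE Bfull Qfree]]] : exists (B : 'M[F]_(I, d)) (Q : 'M[F]_(d, L)),
    [/\ p = B *m Q, row_full B & row_free Q].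
  by exists (col_base p), (row_base p); rewrite mulmx_base col_base_full row_base_free.
have pil i l : p i l = \sum_j B i j * Q j l by rewrite [in LHS]pE mxE.
pose b (j : nat) : {poly F} :=
  \sum_i oapp (B i) 0 (insub j) *: falling_poly F i.
have bE (j : 'I_d) : b j = \sum_i B i j *: falling_poly F i.
  by apply: eq_bigr => i _; rewrite valK.
have h0 : T%:R != 0 :> F by rewrite pnatr_eq0 -lt0n.
have bfree (a : nat -> F) : \sum_(j < d) a j *: b j = 0 ->
    forall j, (j < d)%N -> a j = 0.
  move=> ab0 j jd.
  have /row_fullP[B' B'B] := Bfull.
  pose ac : 'cV_d := \col_j a j.
  have Bac : B *m ac = 0.
    apply/matrixP => i z; rewrite ord1 [RHS]mxE.
    apply: (falling_poly_free F I (fun i => (B *m ac) i 0)).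
    rewrite -[RHS]ab0; under [RHS]eq_bigr do rewrite bE scaler_sumr.
    rewrite exchange_big/=; apply: eq_bigr => i' _.
    rewrite mxE scaler_suml; apply: eq_bigr => j' _.
    by rewrite mxE scalerA mulrC.
  have := congr1 (fun M : 'cV_d => M (Ordinal jd) 0) (mulmxA B' B ac).
  by rewrite B'B Bac mulmx0 mul1mx !mxE/= => <-.
pose W := \det (casorati F T%:R d b).
have W0 : W != 0 by apply: casorati_det_neq0.
(* The vanishing hypothesis now says that [v r] is orthogonal to the values of the [b_j] at
   [k r + s T], for all [s < S]. *)
pose v (r : nat) : 'rV[F]_d := \row_j \sum_l Q j l * lam ^+ (l * r).
have bv (r s : nat) : (r < R0)%N -> (s < S)%N ->
    \sum_(j < d) v r 0 j * (b j).[(k * r + s * T)%:R] = 0.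
  move=> rR sS; rewrite -[RHS](vanish r s rR sS).
  under eq_bigr do rewrite bE horner_sum mulr_sumr.
  rewrite exchange_big/=; apply: eq_bigr => i _.
  under [RHS]eq_bigr do rewrite pil !mulr_suml.
  rewrite [RHS]exchange_big/=; apply: eq_bigr => j _.
  rewrite mxE mulr_suml; apply: eq_bigr => l _.
  by rewrite hornerZ falling_poly_nat; ring.
pose j0 := Ordinal d0.
(* [v r = 0] makes [lam ^+ r] a root of this non-zero polynomial of degree less than [L]; the powers
   being distinct, at least [R0 - L] of the vectors [v r] are non-zero. *)
pose q := \poly_(l < L) oapp (Q j0) 0 (insub l).
have q0 : q != 0.
  apply/eqP => q0; have /row_freeP[Q' QQ'] := Qfree.
  have : row j0 Q = 0.
    apply/rowP => l; rewrite !mxE.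
    by have := congr1 (fun q : {poly F} => q`_l) q0;
      rewrite coef0 coef_poly ltn_ord valK.
  move=> /(congr1 (mulmx^~ Q')); rewrite -row_mul QQ' mul0mx.
  by move=> /rowP/(_ j0); rewrite !mxE eqxx => /eqP; rewrite oner_eq0.
have qv (r : nat) : v r = 0 -> root q (lam ^+ r).
  move=> /rowP/(_ j0); rewrite !mxE => v0; rewrite /root horner_poly -[X in _ == X]v0.
  by apply/eqP; apply: eq_bigr => l _; rewrite valK/= -exprM mulnC.
pose good := [seq r <- iota 0 R0 | v r != 0].
have good_size : (R0 - L <= size good)%N.
  pose bad := [seq r <- iota 0 R0 | v r == 0].
  have sz : (size bad + size good = R0)%N.
    by rewrite !size_filter -[RHS](size_iota 0) count_predC.
  suff : (size bad <= L)%N by lia.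
  rewrite -(size_map (fun r => lam ^+ r)); apply: ltnW.
  apply: (@leq_trans (size q)); last exact: size_poly.
  apply: max_poly_roots => //.
  - by apply/allP => x /mapP[r]; rewrite mem_filter => /andP[/eqP vr _] ->; apply: qv.
  - rewrite map_inj_in_uniq ?filter_uniq ?iota_uniq// => r r'.
    rewrite !mem_filter !mem_iota !add0n => /andP[_ /andP[_ rR]].
    by move=> /andP[_ /andP[_ rR']]; apply: laminj.

(* At these points [v r] is a kernel vector of the evaluated Casorati matrix, so [W] vanishes there.
   Only [s < S - L] is allowed, since the rows add further shifts [s' < d <= L]. *)
pose rs := [seq (k * r + s * T)%:R : F | r <- good, s <- iota 0 (S - L)].
have szrs : (size rs < size W)%N.
  apply: max_poly_roots => //.
    apply/allP => x /allpairsP[[r s]/= [+ + ->]].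
    rewrite mem_filter !mem_iota !add0n => /andP[vr /andP[_ rR]] /andP[_ sS].
    rewrite /root -horner_evalE -det_map_mx -det_tr; apply/det0P.
    exists (v r) => //; apply/rowP => s'; rewrite [LHS]mxE [RHS]mxE.
    have s'd := ltn_ord s'.
    have ss'S : (s + s' < S)%N by lia.
    rewrite -[RHS](bv r (s + s')%N rR ss'S); apply: eq_bigr => j _.
    rewrite !mxE /= horner_evalE horner_comp !hornerE; congr (_ * _.[_]).
    by rewrite mulnDl addnA !natrD !natrM.
  apply: allpairs_uniq; rewrite ?filter_uniq ?iota_uniq// => -[r s] [r' s'].
  move=> /allpairsP[[r1 s1]/= [+ _ [-> ->]]] /allpairsP[[r2 s2]/= [+ _ [-> ->]]].
  rewrite !mem_filter !mem_iota !add0n => /andP[_ /andP[_ r1R]] /andP[_ /andP[_ r2R]].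
  move=> /eqP; rewrite eqr_nat => /eqP rsE.
  have r12 : r1 = r2.
    apply: kinj => //; have := congr1 (modn^~ T) rsE.
    by rewrite ![(_ + _ * T)%N]addnC !modnMDl.
  move: rsE; rewrite r12 => /eqP; rewrite eqn_add2l eqn_pmul2r// => /eqP ->.
  by [].
have szW : (size W <= (d * I).+1)%N.
  apply: size_det_leq => s j; rewrite mxE size_comp_poly2 ?size_XaddC//.
  apply: (leq_trans (size_sum _ _ _)); apply/bigmax_leqP => i _.
  by rewrite (leq_trans (size_scale_leq _ _))// size_falling_poly.
move: szrs; rewrite size_allpairs size_iota => szrs.
have : (size good * (S - L) <= L * I)%N.
  rewrite (leq_trans (_ : _ <= d * I)%N) ?leq_mul2r ?dL ?orbT//.
  by rewrite -ltnS (leq_trans szrs).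
rewrite leqNgt (leq_trans LIRS)// leq_mul2r good_size orbT//.
Qed.

(** * Powers of an algebraic number on the unit circle *)

(** The modulus as an element of [R]: the generic norm on [R[i]] takes its values in [R[i]]. *)
Definition cabs (R : rcfType) (z : R[i]) : R := Normc.normc z.

Lemma cabsM (R : rcfType) (x y : R[i]) : cabs R (x * y) = cabs R x * cabs R y.
Proof. exact: Normc.normcM. Qed.

Lemma cabsD (R : rcfType) (x y : R[i]) : cabs R (x + y) <= cabs R x + cabs R y.
Proof. exact: le_normcD. Qed.

Lemma cabsN (R : rcfType) (x : R[i]) : cabs R (- x) = cabs R x.
Proof. exact: normcN. Qed.

Lemma cabs0 (R : rcfType) : cabs R 0 = 0. Proof. exact: Normc.normc0. Qed.

Lemma cabs1 (R : rcfType) : cabs R 1 = 1. Proof. exact: Normc.normc1. Qed.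

Lemma cabs_ge0 (R : rcfType) (x : R[i]) : 0 <= cabs R x.
Proof. by case: x => a b; rewrite /cabs/= sqrtr_ge0. Qed.

Lemma cabs_eq0 (R : rcfType) (x : R[i]) : (cabs R x == 0) = (x == 0).
Proof.
apply/eqP/eqP => [|->]; last exact: cabs0.
exact: Normc.eq0_normc.
Qed.

Lemma cabs_gt0 (R : rcfType) (x : R[i]) : (0 < cabs R x) = (x != 0).
Proof. by rewrite lt_def cabs_eq0 cabs_ge0 andbT. Qed.

Lemma cabsB (R : rcfType) (x y : R[i]) : cabs R (x - y) <= cabs R x + cabs R y.
Proof. by rewrite -[cabs R y]cabsN cabsD. Qed.

Lemma cabs_subC (R : rcfType) (x y : R[i]) : cabs R (x - y) = cabs R (y - x).
Proof. by rewrite -cabsN opprB. Qed.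

Lemma cabsX (R : rcfType) (x : R[i]) (n : nat) : cabs R (x ^+ n) = cabs R x ^+ n.
Proof. by elim: n => [|n IHn]; rewrite ?cabs1// !exprS cabsM IHn. Qed.

Lemma cabs_sum (R : rcfType) (J : Type) (r : seq J) (P : pred J) (F : J -> R[i]) :
  cabs R (\sum_(j <- r | P j) F j) <= \sum_(j <- r | P j) cabs R (F j).
Proof.
elim/big_ind2: _ => [|x a y b xa yb|//]; first by rewrite cabs0.
by rewrite (le_trans (cabsD _ _ _))// lerD.
Qed.

Lemma cabs_prod (R : rcfType) (J : Type) (r : seq J) (P : pred J) (F : J -> R[i]) :
  cabs R (\prod_(j <- r | P j) F j) = \prod_(j <- r | P j) cabs R (F j).
Proof.
by elim/big_ind2: _ => [|x a y b <- <-|//]; rewrite ?cabs1 ?cabsM.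
Qed.

Lemma cabs_real (R : rcfType) (x : R) : cabs R (x%:C)%C = `|x|.
Proof. by rewrite /cabs/= expr0n/= addr0 sqrtr_sqr. Qed.

Lemma cabs_int (R : rcfType) (m : int) : cabs R m%:~R = `|m|%:~R.
Proof. by rewrite -(rmorph_int (real_complex R)) cabs_real -intr_norm. Qed.

Lemma cabs_nat (R : rcfType) (m : nat) : cabs R m%:R = m%:R.
Proof. by rewrite -[m%:R]/(m%:Z%:~R) cabs_int. Qed.

Lemma cabsV (R : rcfType) (x : R[i]) : cabs R x^-1 = (cabs R x)^-1.
Proof. exact: Normc.normcV. Qed.

Lemma cabs_Re_Im (R : rcfType) (x : R[i]) :
  cabs R x <= `|complex.Re x| + `|complex.Im x|.
Proof.
rewrite {1}(complexE x) (le_trans (cabsD _ _ _))// cabsM !cabs_real.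
by rewrite /cabs/= expr0n/= add0r expr1n sqrtr1 mul1r.
Qed.

Lemma Re_le_cabs (R : rcfType) (x : R[i]) : `|complex.Re x| <= cabs R x.
Proof.
case: x => a b; rewrite /cabs/= -sqrtr_sqr ler_sqrt ?addr_ge0 ?sqr_ge0//.
by rewrite lerDl sqr_ge0.
Qed.

Lemma Im_le_cabs (R : rcfType) (x : R[i]) : `|complex.Im x| <= cabs R x.
Proof.
case: x => a b; rewrite /cabs/= -sqrtr_sqr ler_sqrt ?addr_ge0 ?sqr_ge0//.
by rewrite lerDr sqr_ge0.
Qed.

Lemma cabs_sub_ge (R : rcfType) (x y : R[i]) : cabs R x - cabs R y <= cabs R (x - y).
Proof. by rewrite lerBlDr (le_trans _ (cabsD _ _ _))// subrK. Qed.

Lemma cabs_exp_sub (R : rcfType) (x y : R[i]) (n : nat) :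
  cabs R x = 1 -> cabs R y = 1 ->
  cabs R (x ^+ n - y ^+ n) <= n%:R * cabs R (x - y).
Proof.
move=> x1 y1; rewrite subrXX cabsM mulrC ler_wpM2r ?cabs_ge0//.
rewrite (le_trans (cabs_sum _ _ _ _ _))//.
rewrite (le_trans (ler_sum _ (G := fun=> 1) _))//.
  by move=> i _; rewrite cabsM !cabsX x1 y1 !expr1n mulr1.
by rewrite sumr_const card_ord.
Qed.

Definition cis (R : realType) (x : R) : R[i] := (cos x +i* sin x)%C.

Lemma cisD (R : realType) (x y : R) : cis R (x + y) = cis R x * cis R y.
Proof.
rewrite /cis cosD sinD; apply/eqP.
by rewrite eq_complex/= [X in _ && (X == _)]addrC !eqxx.
Qed.

Lemma cis0 (R : realType) : cis R 0 = 1.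
Proof. by rewrite /cis cos0 sin0. Qed.

Lemma cisX (R : realType) (x : R) (n : nat) : cis R x ^+ n = cis R (n%:R * x).
Proof.
elim: n => [|n IHn]; first by rewrite mul0r cis0.
by rewrite exprS IHn -cisD -natr1 mulrDl mul1r addrC.
Qed.

Lemma cabs_cis (R : realType) (x : R) : cabs R (cis R x) = 1.
Proof. by rewrite /cabs/cis/= cos2Dsin2 sqrtr1. Qed.

Lemma cis_2pi_nat (R : realType) (k : nat) : cis R (k%:R * (2 * pi)) = 1.
Proof.
rewrite -cisX; have -> : cis R (2 * pi) = 1; last by rewrite expr1n.
by rewrite mulr_natl /cis cos2pi sin2pi.
Qed.

Lemma cos_lip (R : realType) (x y : R) : `|cos x - cos y| <= `|x - y|.
Proof.
wlog xy : x y / x <= y.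
  by move=> H; have [/H//|/ltW/H] := leP x y; rewrite distrC [in leRHS]distrC.
have [c _ cE] : exists2 c, c \in `[x, y] & cos y - cos x = - sin c * (y - x).
  apply: (MVT_segment xy) => //.
  by apply: continuous_subspaceT => z; apply: continuous_cos.
by rewrite distrC cE normrM normrN distrC ler_piMl// sin_max.
Qed.

Lemma sin_lip (R : realType) (x y : R) : `|sin x - sin y| <= `|x - y|.
Proof.
by rewrite -!cosBpihalf (le_trans (cos_lip _ _ _))// opprB addrA subrK.
Qed.

Lemma cis_lip (R : realType) (x y : R) : cabs R (cis R x - cis R y) <= 2 * `|x - y|.
Proof.
rewrite (le_trans (cabs_Re_Im _ _))// mulr_natl mulr2n.
by rewrite lerD// ?cos_lip ?sin_lip.
Qed.

(* Mean value theorem for [sin] on [0, |x|], where [cos >= 1 / 2]. *)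
Lemma norm_le_cis_sub1 (R : realType) (x : R) :
  `|x| <= pi -> cabs R (cis R x - 1) <= 2^-1 -> `|x| <= 2 * cabs R (cis R x - 1).
Proof.
move=> xpi small.
have cosx : 2^-1 <= cos x.
  have := le_trans (Re_le_cabs _ _) small; rewrite /= ler_norml => /andP[+ _].
  lra.
have sinx : `|sin x| <= cabs R (cis R x - 1).
  by rewrite (le_trans _ (Im_le_cabs _ _))//= subr0.
rewrite (le_trans _ (ler_wpM2l _ sinx))//.
have -> : `|sin x| = `|sin `|x| |.
  by case: (ger0P x) => // _; rewrite sinN normrN.
rewrite -cos_norm in cosx; set y := `|x| in xpi cosx *.
have y0 : 0 <= y by apply: normr_ge0.
have [c cy cE] : exists2 c, c \in `[0, y] & sin y - sin 0 = cos c * (y - 0).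
  apply: (MVT_segment y0) => //.
  by apply: continuous_subspaceT => z; apply: continuous_sin.
move: cE; rewrite sin0 !subr0 => ->.
have : cos y <= cos c.
  move: cy; rewrite in_itv/= => /andP[c0 cy].
  have := @ltr_cos R y c; rewrite !in_itv/= y0 xpi c0 (le_trans cy xpi).
  move=> /(_ isT isT) E; rewrite leNgt E -leNgt//.
move=> ycc; rewrite ger0_norm; last by rewrite mulr_ge0//; lra.
rewrite mulrA ler_peMl//; lra.
Qed.

Lemma unit_circle_cis (R : realType) (z : R[i]) : cabs R z = 1 ->
  exists2 x : R, 0 <= x <= 2 * pi & z = cis R x.
Proof.
case: z => u v uv1.
have uv : u ^+ 2 + v ^+ 2 = 1.
  move: uv1; rewrite /cabs/= => /(congr1 (fun x => x ^+ 2)).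
  by rewrite sqr_sqrtr ?expr1n// addr_ge0 ?sqr_ge0.
have u1 : -1 <= u <= 1.
  by apply/andP; split; nra.
have v2 : Num.sqrt (1 - u ^+ 2) = `|v| by rewrite -uv addrC addKr sqrtr_sqr.
have a0 := acos_ge0 u1; have api := acos_lepi u1.
have [v0|v0] := leP 0 v.
  exists (acos u); first by rewrite a0/=; have := pi_ge0 R; lra.
  by rewrite /cis acosK ?in_itv//= sin_acos// v2 ger0_norm.
exists (2 * pi - acos u); first by apply/andP; split; lra.
rewrite /cis addrC mulr_natl.
rewrite (cosD2pi (- acos u)) (sinD2pi (- acos u)) cosN sinN.
by rewrite acosK ?in_itv//= sin_acos// v2 ltr0_norm// opprK.
Qed.

(** Write [lam = e^(i x)], take [om = e^(2 pi i / T)] and [k] the integer nearest to [T x / (2 pi)].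
    Then [lam^T = e^(i eta)] with [eta = T x - 2 pi k] and [|eta| <= pi], so [|eta|] is at most
    [2 |lam^T - 1|]. The constant 16 comes from [cis_lip] and [pi <= 4]. *)
Lemma root_of_unity_near (R : realType) (lam : R[i]) (T : nat) :
  (0 < T)%N -> cabs R lam = 1 -> cabs R (lam ^+ T - 1) <= 2^-1 ->
  exists (om : R[i]) (k : nat),
    [/\ om ^+ T = 1, cabs R om = 1, cabs R (om - 1) <= 16 / T%:R, (k <= T)%N &
        cabs R (lam - om ^+ k) <= 4 * cabs R (lam ^+ T - 1)].
Proof.
move=> T0 lam1 small; have TR0 : 0 < T%:R :> R by rewrite ltr0n.
have [x /andP[x0 x2pi] lamE] := unit_circle_cis R lam lam1.
have pi0 := pi_gt0 R; have pi4 : pi <= 4 :> R.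
  by have := pihalf_02 R => /andP[_]; lra.
pose y := T%:R * x / (2 * pi) + 2^-1.
have y0 : 0 <= y by rewrite addr_ge0// divr_ge0 ?mulr_ge0//; lra.
have [k /andP[ky yk]] : exists k : nat, k%:R <= y < k.+1%:R.
  by exists (Num.truncn y); rewrite Num.Theory.truncn_itv.
exists (cis R (2 * pi / T%:R)), k.
have omE (j : nat) : cis R (2 * pi / T%:R) ^+ j = cis R (j%:R * (2 * pi) / T%:R).
  by rewrite cisX mulrA.
pose eta := T%:R * x - k%:R * (2 * pi).
have lamT : lam ^+ T = cis R eta.
  by rewrite lamE cisX -[in RHS](mulr1 (cis R eta)) -(cis_2pi_nat R k) -cisD subrK.
have etapi : `|eta| <= pi.
  have -> : eta = (y - 2^-1 - k%:R) * (2 * pi).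
    rewrite /y /eta; field; lra.
  rewrite normrM [`|2 * pi|]gtr0_norm; last lra.
  have : `|y - 2^-1 - k%:R| <= 2^-1.
    by rewrite ler_norml; move: ky yk; rewrite -natr1; lra.
  move=> H; rewrite (le_trans (ler_wpM2r _ H))//; lra.
split.
- by rewrite omE mulrAC divff ?gt_eqF// mul1r -[2 * pi]mul1r (cis_2pi_nat R 1).
- exact: cabs_cis.
- rewrite -cis0 (le_trans (cis_lip _ _ _))// subr0 ger0_norm ?divr_ge0//; last lra.
  by rewrite mulrA ler_wpM2r ?invr_ge0//; lra.
- rewrite -ltnS -(ltr_nat R) -natr1.
  have : y <= T%:R + 2^-1.
    by rewrite lerD2r ler_pdivrMr; [rewrite ler_wpM2l// ler0n|lra].
  lra.
- rewrite {1}lamE omE (le_trans (cis_lip _ _ _))//.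
  have -> : x - k%:R * (2 * pi) / T%:R = eta / T%:R.
    by rewrite /eta; field; lra.
  rewrite normrM [`|T%:R^-1|]ger0_norm ?invr_ge0//.
  have := norm_le_cis_sub1 R eta etapi; rewrite -lamT => /(_ small) H.
  have T1 : T%:R^-1 <= 1 :> R by rewrite invf_le1// ler1n.
  have : `|eta| / T%:R <= `|eta| by rewrite ler_piMr.
  lra.
Qed.

(** * The auxiliary polynomial: box principle and Newton expansions *)

(** Dirichlet's box principle: on vectors with entries in [0..H] each form takes values in an
    interval of length [2 H W]. Two vectors whose values fall in the same cells of width [2 H W / N]
    have the required difference. *)
Lemma pigeonhole_forms (R : realType) (X Y : finType) (a : Y -> X -> R)
    (H N : nat) (W : R) :
  (0 < N)%N -> 0 < W -> (forall y, \sum_x `|a y x| <= W) ->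
  (N.+1 ^ #|Y| < H.+1 ^ #|X|)%N ->
  exists p : X -> int,
    [/\ exists x, p x != 0, forall x, `|p x| <= H%:Z &
        forall y, `|\sum_x (p x)%:~R * a y x| <= 2 * H%:R * W / N%:R].
Proof.
move=> N0 W0 aW card; have NR : 0 < N%:R :> R by rewrite ltr0n.
have H0 : (0 < H)%N.
  by rewrite lt0n; apply: contraL card => /eqP ->; rewrite exp1n -leqNgt expn_gt0.
have HR : 0 < H%:R :> R by rewrite ltr0n.
pose D := 2 * H%:R * W; have D0 : 0 < D by rewrite /D !mulr_gt0.
pose val_ (v : {ffun X -> 'I_H.+1}) y := \sum_x (v x)%:R * a y x.
have valH v y : `|val_ v y| <= H%:R * W.
  rewrite (le_trans (ler_norm_sum _ _ _))//.
  rewrite (le_trans _ (ler_wpM2l (ltW HR) (aW y)))// mulr_sumr ler_sum// => x _.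
  by rewrite normrM ler_wpM2r// normr_nat ler_nat -ltnS.
pose box v y := (val_ v y + H%:R * W) * N%:R / D.
have box0 v y : 0 <= box v y <= N%:R.
  have := valH v y; rewrite ler_norml => /andP[v1 v2].
  have v0 : 0 <= val_ v y + H%:R * W by lra.
  have N0' := ltW NR; have D0' := ltW D0.
  apply/andP; split; first exact: (divr_ge0 (mulr_ge0 v0 N0') D0').
  by rewrite ler_pdivrMr// [leRHS]mulrC ler_pM2r// /D; lra.
(* There are [N.+1] cells per form because [box] may reach the right endpoint [N]. *)
pose f v : {ffun Y -> 'I_N.+1} := [ffun y => inord (Num.truncn (box v y))].
have [[v v'] /= [vv' fvv']] : exists vw, vw.1 <> vw.2 /\ f vw.1 = f vw.2.
  apply: contrapT => nex.
  have /leq_card : injective f.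
    by move=> v v' fE; apply: contrapT => vv'; apply: nex; exists (v, v').
  by rewrite !card_ffun !card_ord leqNgt card.
exists (fun x => (v x)%:Z - (v' x)%:Z); split.
- apply: contrapT => nex; apply: vv'; apply/ffunP => x; apply/val_inj/eqP.
  rewrite -eqz_nat -subr_eq0; apply/negPn/negP => px; apply: nex.
  by exists x.
- move=> x; have := ltn_ord (v x); have := ltn_ord (v' x); lia.
- move=> y; have := congr1 (fun g : {ffun Y -> 'I_N.+1} => val (g y)) fvv'.
  have trN w : (Num.truncn (box w y) < N.+1)%N.
    rewrite ltnS -(ler_nat R); have /andP[b0 bN] := box0 w y.
    by rewrite (le_trans _ bN)// Num.Theory.truncn_le.
  rewrite !ffunE/= !inordK// => tE.
  have -> : \sum_x ((v x)%:Z - (v' x)%:Z)%:~R * a y x = val_ v y - val_ v' y.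
    by rewrite -sumrB; apply: eq_bigr => x _; rewrite intrB mulrBl.
  have -> : val_ v y - val_ v' y = (box v y - box v' y) * (D / N%:R).
    by rewrite /box; field; rewrite !gt_eqF.
  rewrite normrM [`|D / _|]gtr0_norm ?divr_gt0//.
  rewrite -[leRHS]mul1r ler_wpM2r ?divr_ge0 ?(ltW D0) ?(ltW NR)//.
  have /andP[b0 _] := box0 v y; have /andP[b0' _] := box0 v' y.
  have := Num.Theory.truncn_itv b0; have := Num.Theory.truncn_itv b0'.
  rewrite tE -natr1 => /andP[c1 c2] /andP[c3 c4].
  by rewrite ler_norml; apply/andP; split; lra.
Qed.

Lemma ffactnD (M i j : nat) : (M ^_ (i + j) = M ^_ i * (M - i) ^_ j)%N.
Proof.
elim: j => [|j IHj]; first by rewrite addn0 muln1.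
by rewrite addnS !ffactnSr IHj subnDA mulnA.
Qed.

Lemma ffact_le_exp (M i : nat) : (M ^_ i <= M ^ i)%N.
Proof.
elim: i => [|i IHi]; first by rewrite ffactn0.
by rewrite ffactnSr expnSr leq_mul// leq_subr.
Qed.

Lemma exp_div_fact_le (R : realType) (x : R) (n : nat) :
  0 <= x -> x ^+ n / n`!%:R <= expR x.
Proof.
move=> x0; case: n => [|n]; first by rewrite expr0 fact0 divr1 (le_trans _ (expR_ge1Dx x))// lerDl.
by rewrite (le_trans _ (expR_ge1Dxn n x0))// lerDr.
Qed.

(** The coefficient of [M ^_ (i + j)] in the Newton expansion of [M |-> M ^_ i * z ^+ M]. *)
Definition newton_term (R : realType) (z : R[i]) (i j : nat) : R[i] :=
  z ^+ i * (z - 1) ^+ j / j`!%:R.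

Lemma cabs_newton_term (R : realType) (z : R[i]) (i j : nat) (Mx X : R) :
  cabs R z = 1 -> 0 <= Mx -> Mx * cabs R (z - 1) <= X ->
  Mx ^+ (i + j) * cabs R (newton_term R z i j) <= Mx ^+ i * (X ^+ j / j`!%:R).
Proof.
move=> z1 Mx0 MzX.
rewrite /newton_term !cabsM cabsV cabs_nat !cabsX z1 expr1n mul1r exprD -mulrA.
rewrite ler_wpM2l ?exprn_ge0// mulrA -exprMn ler_wpM2r ?invr_ge0//.
by rewrite lerXn2r ?nnegrE ?mulr_ge0 ?cabs_ge0// (le_trans _ MzX)// mulr_ge0 ?cabs_ge0.
Qed.

(** Expand [z^(M - i) = (1 + (z - 1))^(M - i)] by the binomial theorem and use
    [M ^_ i * (M - i) ^_ j = M ^_ (i + j)]; the terms with [i + j > M] vanish. *)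
Lemma newton_sum (R : realType) (z : R[i]) (i M K : nat) : (M < K)%N ->
  (M ^_ i)%:R * z ^+ M = \sum_(j < K) (M ^_ (i + j))%:R * newton_term R z i j.
Proof.
move=> MK; have [iM|Mi] := leqP i M; last first.
  rewrite ffact_small// mul0r big1// => j _.
  by rewrite ffact_small ?mul0r// ltn_addr.
rewrite -{2}(subnKC iM) exprD -{2}(subrK 1 z) exprD1n.
rewrite (big_ord_widen K (fun j => (z - 1) ^+ j *+ 'C(M - i, j))); last by lia.
rewrite big_mkcond/= !mulr_sumr; apply: eq_bigr => j _.
have j0 : (j`!)%:R != 0 :> R[i] by rewrite pnatr_eq0 -lt0n fact_gt0.
rewrite ffactnD -(bin_ffact (M - i)) !natrM /newton_term; case: ifPn => [_|].
  by rewrite -[(z - 1) ^+ j *+ _]mulr_natl; field.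
by rewrite -leqNgt => Mij; rewrite bin_small// !(mul0r, mulr0).
Qed.

(** The omitted terms are dominated by [Mx^i X^j / j!], and [X^j / j! <= e^(4 X) / 4^j] makes the
    tail geometric. *)
Lemma newton_approx (R : realType) (z : R[i]) (i M d : nat) (Mx X : R) :
  cabs R z = 1 -> M%:R <= Mx -> Mx * cabs R (z - 1) <= X ->
  cabs R ((M ^_ i)%:R * z ^+ M
          - \sum_(j < d) (M ^_ (i + j))%:R * newton_term R z i j)
    <= Mx ^+ i * (2 / 4 ^+ d) * expR (4 * X).
Proof.
move=> z1 MMx MzX; have Mx0 : 0 <= Mx by rewrite (le_trans _ MMx).
have X0 : 0 <= X by rewrite (le_trans _ MzX)// mulr_ge0 ?cabs_ge0.
rewrite (newton_sum R z i M (d + M.+1)) ?leq_addl// big_split_ord/= addrAC subrr add0r.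
rewrite (le_trans (cabs_sum _ _ _ _ _))//.
have term j : cabs R ((M ^_ (i + (d + j)))%:R * newton_term R z i (d + j)) <=
    Mx ^+ i * expR (4 * X) / 4 ^+ d * (4^-1) ^+ j.
  rewrite cabsM cabs_nat.
  rewrite (@le_trans _ _ (Mx ^+ (i + (d + j)) * cabs R (newton_term R z i (d + j))))//.
    rewrite ler_wpM2r ?cabs_ge0// (@le_trans _ _ ((M ^ (i + (d + j)))%:R))//.
      by rewrite ler_nat ffact_le_exp.
    by rewrite natrX lerXn2r ?nnegrE.
  rewrite (le_trans (cabs_newton_term R z i _ Mx X z1 Mx0 MzX))//.
  rewrite -!mulrA ler_wpM2l ?exprn_ge0//.
  have := exp_div_fact_le R (4 * X) (d + j) (mulr_ge0 (ler0n _ _) X0).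
  rewrite exprMn -mulrA => H.
  rewrite exprVn -invfM -exprD ler_pdivlMr ?exprn_gt0// mulrC//.
apply: (@le_trans _ _ (\sum_(j < M.+1) Mx ^+ i * expR (4 * X) / 4 ^+ d * (4^-1) ^+ j)).
  by apply: ler_sum => j _; apply: term.
rewrite -mulr_sumr.
have geo n : \sum_(j < n) (4^-1 : R) ^+ j <= 2.
  suff : \sum_(j < n) (4^-1 : R) ^+ j <= 2 - 2 * (4^-1) ^+ n.
    by move=> /le_trans; apply; rewrite gerBl mulr_ge0// exprn_ge0// invr_ge0.
  elim: n => [|n IHn]; first by rewrite big_ord0 expr0; lra.
  rewrite big_ord_recr/= (le_trans (lerD IHn (lexx _)))// exprS.
  have : 0 <= (4^-1 : R) ^+ n by rewrite exprn_ge0// invr_ge0.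
  lra.
rewrite (le_trans (ler_wpM2l _ (geo _)))//.
  by rewrite !mulr_ge0 ?expR_ge0 ?invr_ge0 ?exprn_ge0.
by rewrite le_eqVlt; apply/orP; left; apply/eqP; ring.
Qed.

Lemma Re_sum_int (R : rcfType) (X : finType) (p : X -> int) (g : X -> R[i]) :
  complex.Re (\sum_x (p x)%:~R * g x) = \sum_x (p x)%:~R * complex.Re (g x).
Proof.
rewrite (big_morph (@complex.Re R) (id1 := 0) (op1 := +%R)) => [|[a b] [c e]|]//.
apply: eq_bigr => x _; rewrite -(rmorph_int (real_complex R)).
by case: (g x) => a b /=; rewrite mul0r subr0.
Qed.

Lemma Im_sum_int (R : rcfType) (X : finType) (p : X -> int) (g : X -> R[i]) :
  complex.Im (\sum_x (p x)%:~R * g x) = \sum_x (p x)%:~R * complex.Im (g x).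
Proof.
rewrite (big_morph (@complex.Im R) (id1 := 0) (op1 := +%R)) => [|[a b] [c e]|]//.
apply: eq_bigr => x _; rewrite -(rmorph_int (real_complex R)).
by case: (g x) => a b /=; rewrite mul0r addr0.
Qed.

Lemma sum_ord_window (V : zmodType) (n i d : nat) (f : nat -> V) : (i + d <= n)%N ->
  \sum_(a < n) (if (i <= a < i + d)%N then f a else 0) = \sum_(j < d) f (i + j)%N.
Proof.
move=> idn; rewrite -big_mkcond/= -(big_mkord (fun a => (i <= a < i + d)%N) f).
rewrite (big_cat_nat _ (n := i))//=; last by lia.
rewrite big_nat_cond big_pred0 ?add0r; last by move=> a; lia.
rewrite (big_cat_nat _ (n := (i + d)%N))//=; last by lia.
rewrite [X in _ + X]big_nat_cond [X in _ + X]big_pred0 ?addr0; last by move=> a; lia.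
rewrite big_nat_cond (eq_bigl (fun a => (i <= a < i + d)%N && true)); last by move=> a; lia.
rewrite -big_nat_cond -{1}(add0n i) big_addn addKn big_mkord.
by apply: eq_bigr => j _; rewrite addnC.
Qed.

(* Pigeonhole on the coefficients of the truncated Newton expansion of *)
(* [M |-> \sum p_il M^_i om^(l M)] in the basis of falling factorials. *)
Lemma auxiliary_polynomial (R : realType) (om : R[i]) (I L T B d H N : nat)
    (W : R) :
  om ^+ T = 1 -> cabs R om = 1 -> cabs R (om - 1) <= 16 / T%:R ->
  (0 < T)%N -> (0 < B)%N -> (0 < I * L)%N -> (0 < N)%N ->
  W = (I * L)%:R * (T * B)%:R ^+ I * expR (64 * (L * B)%:R) ->
  (N.+1 ^ (2 * (I + d)) < H.+1 ^ (I * L))%N ->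
  exists p : 'I_I * 'I_L -> int,
    [/\ exists x, p x != 0, forall x, `|p x| <= H%:Z &
        forall M, (M <= T * B)%N ->
          cabs R (\sum_x (p x)%:~R * ((M ^_ x.1)%:R * (om ^+ x.2) ^+ M))
            <= (I + d)%:R * (4 * H%:R * W / N%:R) + H%:R * W * (2 / 4 ^+ d)].
Proof.
move=> omT om1 om_near T0 B0 IL0 N0 WE card.
(* [X] bounds [Mx |om^l - 1|] for [l < L], because [|om - 1| <= 16 / T]; the factor [e^(4 X)] of
   [newton_approx] is the exponential in [W]. *)
pose Mx : R := (T * B)%:R; pose X : R := 16 * (L * B)%:R.
have Mx1 : 1 <= Mx by rewrite ler1n muln_gt0 T0.
have Mx0 : 0 <= Mx by rewrite ler0n.
have X0 : 0 <= X by rewrite mulr_ge0.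
have WX : W = (I * L)%:R * (Mx ^+ I * expR (4 * X)).
  by rewrite WE mulrA; congr (_ * expR _); rewrite /X; ring.
have W0 : 0 < W.
  have MxP : 0 < Mx by rewrite (lt_le_trans ltr01).
  rewrite WX; apply: mulr_gt0; first by rewrite ltr0n.
  by apply: mulr_gt0; [apply: exprn_gt0 | apply: expR_gt0].
have oml1 l : cabs R (om ^+ l) = 1 by rewrite cabsX om1 expr1n.
have omlX l : (l < L)%N -> Mx * cabs R (om ^+ l - 1) <= X.
  move=> lL; have := cabs_exp_sub R om 1 l om1 (cabs1 R); rewrite expr1n => H1.
  rewrite (le_trans (ler_wpM2l Mx0 H1))//.
  apply: (@le_trans _ _ (Mx * (l%:R * (16 / T%:R)))).
    by rewrite !ler_wpM2l.
  have -> : Mx * (l%:R * (16 / T%:R)) = 16 * (l * B)%:R.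
    by rewrite /Mx !natrM; field; rewrite pnatr_eq0 -lt0n.
  by rewrite /X ler_wpM2l// ler_nat leq_mul2r ltnW ?orbT.
(* The coefficient of [M ^_ a] in the expansion of [M ^_ i * om^(l M)] cut after [d] terms. *)
pose G (a i l : nat) : R[i] :=
  if (i <= a < i + d)%N then newton_term R (om ^+ l) i (a - i) else 0.
have expX4 : expR X <= expR (4 * X) by rewrite ler_expR; lra.
have GX a (x : 'I_I * 'I_L) :
    Mx ^+ a * cabs R (G a x.1 x.2) <= Mx ^+ I * expR (4 * X).
  rewrite /G; case: ifPn => [/andP[ia aid]|_]; last first.
    by rewrite cabs0 mulr0 mulr_ge0 ?expR_ge0 ?exprn_ge0.
  have := cabs_newton_term R (om ^+ x.2) x.1 (a - x.1) Mx X (oml1 _) Mx0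
    (omlX _ (ltn_ord _)).
  rewrite subnKC// => /le_trans; apply; apply: ler_pM.
  - exact: exprn_ge0.
  - by rewrite divr_ge0 ?exprn_ge0.
  - by rewrite ler_weXn2l// ltnW.
  - by rewrite (le_trans _ expX4)// exp_div_fact_le.
have aW (f : R[i] -> R) a : (forall z, `|f z| <= cabs R z) ->
    \sum_(x : 'I_I * 'I_L) `|Mx ^+ a * f (G a x.1 x.2)| <= W.
  move=> fz; rewrite WX mulr_natl.
  have -> : (I * L)%N = #|{: 'I_I * 'I_L}| by rewrite card_prod !card_ord.
  rewrite -sumr_const ler_sum// => x _.
  rewrite normrM ger0_norm ?exprn_ge0// (le_trans _ (GX a x))//.
  by rewrite ler_wpM2l ?exprn_ge0.
(* Real and imaginary parts give [2 (I + d)] real forms; the weight [Mx ^+ a] compensates for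
   [M ^_ a <= Mx ^+ a]. *)
pose a_ (y : 'I_(I + d) * bool) (x : 'I_I * 'I_L) : R :=
  Mx ^+ y.1 * (if y.2 then complex.Re (G y.1 x.1 x.2) else complex.Im (G y.1 x.1 x.2)).
have [||p [p0 pH pW]] := pigeonhole_forms R _ _ a_ H N W N0 W0.
- by move=> [a []]; [apply: (aW (@complex.Re R)) => z; apply: Re_le_cabs
    | apply: (aW (@complex.Im R)) => z; apply: Im_le_cabs].
- by rewrite !card_prod !card_ord card_bool mulnC.
exists p; split=> // M MTB.
have MMx : M%:R <= Mx by rewrite ler_nat.
pose Gs a := \sum_x (p x)%:~R * G a x.1 x.2.
have Gs_small (a : 'I_(I + d)) : Mx ^+ a * cabs R (Gs a) <= 4 * H%:R * W / N%:R.
  apply: (@le_trans _ _ (Mx ^+ a * (`|complex.Re (Gs a)| + `|complex.Im (Gs a)|))).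
    by rewrite ler_wpM2l ?exprn_ge0// cabs_Re_Im.
  have ReE := pW (a, true); have ImE := pW (a, false).
  have mE (f : R[i] -> R) : f (Gs a) = \sum_x (p x)%:~R * f (G a x.1 x.2) ->
      Mx ^+ a * `|f (Gs a)| = `|\sum_x (p x)%:~R * (Mx ^+ a * f (G a x.1 x.2))|.
    move=> ->; rewrite -[X in X * _]ger0_norm ?exprn_ge0// -normrM mulr_sumr.
    by congr `|_|; apply: eq_bigr => x _; rewrite mulrCA.
  rewrite mulrDr (mE (@complex.Re R)) ?Re_sum_int// (mE (@complex.Im R)) ?Im_sum_int//.
  rewrite (le_trans (lerD ReE ImE))//.
  by rewrite le_eqVlt; apply/orP; left; apply/eqP; ring.
pose approx (x : 'I_I * 'I_L) :=
  \sum_(j < d) (M ^_ (x.1 + j))%:R * newton_term R (om ^+ x.2) x.1 j.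
have approxE : \sum_x (p x)%:~R * approx x = \sum_(a < I + d) (M ^_ a)%:R * Gs a.
  under [RHS]eq_bigr do rewrite mulr_sumr.
  rewrite [RHS]exchange_big/=; apply: eq_bigr => x _.
  have xd : (x.1 + d <= I + d)%N by rewrite leq_add2r ltnW.
  pose f a := (M ^_ a)%:R * newton_term R (om ^+ x.2) x.1 (a - x.1).
  transitivity ((p x)%:~R * \sum_(a < I + d) (if (x.1 <= a < x.1 + d)%N then f a else 0)).
    rewrite (sum_ord_window _ _ _ _ f xd); congr (_ * _).
    by apply: eq_bigr => j _; rewrite /f addKn.
  rewrite mulr_sumr; apply: eq_bigr => a _; rewrite mulrCA /G /f.
  by case: ifP; rewrite ?mulr0.
have diff (x : 'I_I * 'I_L) : cabs R ((M ^_ x.1)%:R * (om ^+ x.2) ^+ M - approx x)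
    <= Mx ^+ I * expR (4 * X) * (2 / 4 ^+ d).
  rewrite (le_trans (newton_approx R _ _ _ d Mx X (oml1 _) MMx (omlX _ (ltn_ord _))))//.
  rewrite mulrAC ler_wpM2r ?divr_ge0 ?exprn_ge0// ler_wpM2r ?expR_ge0//.
  by rewrite ler_weXn2l// ltnW.
have -> : \sum_x (p x)%:~R * ((M ^_ x.1)%:R * (om ^+ x.2) ^+ M)
  = \sum_x (p x)%:~R * approx x
    + \sum_x (p x)%:~R * ((M ^_ x.1)%:R * (om ^+ x.2) ^+ M - approx x).
  by rewrite -big_split/=; apply: eq_bigr => x _; rewrite mulrBr addrC subrK.
rewrite (le_trans (cabsD _ _ _))// lerD//.
  rewrite approxE (le_trans (cabs_sum _ _ _ _ _))//.
  rewrite -[X in X%:R * _]card_ord mulr_natl -sumr_const ler_sum// => a _.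
  rewrite (le_trans _ (Gs_small a))// cabsM cabs_nat ler_wpM2r ?cabs_ge0//.
  rewrite (@le_trans _ _ ((M ^ a)%:R))// ?ler_nat ?ffact_le_exp//.
  by rewrite natrX lerXn2r ?nnegrE.
rewrite (le_trans (cabs_sum _ _ _ _ _))//.
have -> : H%:R * W * (2 / 4 ^+ d)
    = (H%:R * (Mx ^+ I * expR (4 * X) * (2 / 4 ^+ d))) *+ (I * L).
  by rewrite WX -[RHS]mulr_natl; ring.
have -> : (I * L)%N = #|{: 'I_I * 'I_L}| by rewrite card_prod !card_ord.
rewrite -sumr_const ler_sum// => x _; rewrite cabsM cabs_int.
apply: ler_pM; rewrite ?cabs_ge0 ?ler0z//.
by rewrite -[H%:R]/(H%:Z%:~R) ler_int.
Qed.

(* The sums range over the values at [lam] of the integer polynomials; [D] is *)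
(* the number of conjugates of [lam] other than itself, and [beta] bounds them. *)
Definition liouville (R : realType) (lam : R[i]) (beta : R) (D : nat) : Prop :=
  forall (X : finType) (c : X -> int) (e : X -> nat),
    \sum_x (c x)%:~R * lam ^+ e x != 0 ->
    1 <= cabs R (\sum_x (c x)%:~R * lam ^+ e x)
         * (\sum_x `|c x|%:~R * beta ^+ e x) ^+ D.

Lemma liouville_exp_sub (R : realType) (lam : R[i]) (beta : R) (D r r' : nat) :
  liouville R lam beta D -> lam ^+ r != lam ^+ r' ->
  1 <= cabs R (lam ^+ r - lam ^+ r') * (beta ^+ r + beta ^+ r') ^+ D.
Proof.
move=> /(_ bool (fun x => if x then 1 else -1) (fun x => if x then r else r')).
rewrite !big_bool/= !mulN1r !mul1r => H rr'; rewrite -subr_eq0 in rr'.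
exact: H.
Qed.

(* The values at [(k r + s T, lam ^ r)] of the auxiliary polynomial are too *)
(* small for Liouville's inequality, so they vanish, against [zero_estimate]. *)
Lemma no_close_root (R : realType) (lam om : R[i]) (beta : R)
    (D I L R0 S T k u : nat) (w := (3 * D + 5)%N) :
  liouville R lam beta D -> cabs R lam = 1 -> 1 <= beta ->
  (forall a, (0 < a)%N -> lam ^+ a != 1) ->
  om ^+ T = 1 -> cabs R om = 1 -> cabs R (om - 1) <= 16 / T%:R ->
  (k <= T)%N -> (0 < T)%N -> (0 < R0)%N -> (0 < L)%N -> (3 <= u)%N ->
  (L * I < (R0 - L) * (S - L))%N ->
  (I * L)%:R * (T * (R0 + S))%:R ^+ I * expR (64 * (L * (R0 + S))%:R) <= 2 ^+ u :> R ->
  beta ^+ (L * R0) <= 2 ^+ u ->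
  (I + w * u <= 2 ^ u)%N -> (L * R0 <= 2 ^ u)%N ->
  (2 * w.+1 * (I + w * u) <= I * L)%N ->
  cabs R (lam - om ^+ k) * 2 ^+ (w * u) <= 1 ->
  False.
Proof.
move=> Hliou lam1 beta1 nru omT om1 om_near kT T0 R00 L0 u3 zeroc HW Hbeta HId HLR Hn close.
have w1 : ((2 * D + 1).+1 <= w)%N by rewrite /w; lia.
have w2 : (0 < w)%N by rewrite /w; lia.
pose U : R := 2 ^+ u.
have U8 : 8 <= U.
  have -> : 8 = 2 ^+ 3 :> R by ring.
  by rewrite ler_weXn2l// ler1n.
have beta0 : 0 <= beta by lra.
have U0 : 0 < U by lra.
have U1 : 1 <= U by lra.
pose d := (w * u)%N; pose B := (R0 + S)%N.
pose N := (2 ^ (w * u))%N; pose H := (2 ^ u)%N.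
have HE : H%:R = U by rewrite /H natrX.
have NE : N%:R = U ^+ w by rewrite /N natrX /U -exprM mulnC.
have Uw0 : 0 < U ^+ w by rewrite exprn_gt0.
pose eps := cabs R (lam - om ^+ k).
have eps0 : 0 <= eps by apply: cabs_ge0.
have epsU : eps * U ^+ w <= 1 by rewrite /U -exprM [(u * w)%N]mulnC.
have IL0 : (0 < I * L)%N.
  have wu0 : (0 < w * u)%N by rewrite muln_gt0 w2 (leq_trans _ u3).
  by rewrite (leq_trans _ Hn)// muln_gt0/= addn_gt0 wu0 orbT.
have I0 : (0 < I)%N by move: IL0; rewrite muln_gt0 => /andP[].
have B0 : (0 < B)%N by rewrite /B addn_gt0 R00.
have N0 : (0 < N)%N by rewrite expn_gt0.
have card : (N.+1 ^ (2 * (I + d)) < H.+1 ^ (I * L))%N.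
  apply: (@leq_ltn_trans ((2 ^ (w.+1 * u)) ^ (2 * (I + d)))).
    rewrite leq_exp2r; last by rewrite muln_gt0 addn_gt0 I0.
    rewrite mulSn expnD -/N (leq_trans (_ : N.+1 <= 2 * N)%N)//.
      by rewrite mul2n -addnn -addn1 leq_add2l.
    by rewrite leq_mul2r -{1}(expn1 2) leq_exp2l ?(leq_trans _ u3)// orbT.
  apply: (@leq_ltn_trans (H ^ (I * L))); last by rewrite ltn_exp2r.
  rewrite -!expnM leq_exp2l//.
  rewrite (_ : (_ * _ = u * (2 * w.+1 * (I + w * u)))%N); last by rewrite /d; ring.
  by rewrite leq_mul2l Hn orbT.
pose W : R := (I * L)%:R * (T * B)%:R ^+ I * expR (64 * (L * B)%:R).
have W0 : 0 <= W by rewrite !mulr_ge0 ?exprn_ge0 ?expR_ge0.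
have WU : W <= U by [].
have [p [[x0 px0] pH pM]] := auxiliary_polynomial R om I L T B d H N W
  omT om1 om_near T0 B0 IL0 N0 erefl card.
have TB1 : 1 <= (T * B)%:R :> R by rewrite ler1n muln_gt0 T0.
have ILTB : (I * L)%:R * (T * B)%:R ^+ I <= U.
  rewrite (le_trans _ WU)// /W ler_peMr ?mulr_ge0 ?exprn_ge0//.
  by rewrite -expR0 ler_expR mulr_ge0.
have lamU (x y : R[i]) (l r : nat) : cabs R x = 1 -> cabs R y = 1 ->
    (l < L)%N -> (r < R0)%N -> cabs R (x ^+ (l * r) - y ^+ (l * r)) <= U * cabs R (x - y).
  move=> x1 y1 lL rR; rewrite (le_trans (cabs_exp_sub _ _ _ _ x1 y1))//.
  rewrite ler_wpM2r ?cabs_ge0// -HE ler_nat (leq_trans _ HLR)//.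
  by rewrite leq_mul// ltnW.
have omk1 : cabs R (om ^+ k) = 1 by rewrite cabsX om1 expr1n.
have lam0 : lam != 0 by rewrite -cabs_eq0 lam1 oner_eq0.
have laminj r r' : lam ^+ r = lam ^+ r' -> r = r'.
  wlog rr' : r r' / (r <= r')%N.
    by move=> Hw; have [/Hw//|/ltnW/Hw Hw' E] := leqP r r'; rewrite Hw'.
  move=> E; apply/eqP; rewrite eqn_leq rr' leqNgt; apply/negP => lt.
  have := nru (r' - r)%N; rewrite subn_gt0 lt => /(_ isT)/eqP; apply.
  apply: (mulfI (expf_neq0 r lam0)).
  by rewrite -exprD subnKC// mulr1.
(* If [k r = k r'] modulo [T], then [om^(k r) = om^(k r')], so [lam^r] and [lam^r'] are at distance
   at most [2 U eps]. Liouville's inequality forbids this unless they are equal. *)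
have kinj (r r' : nat) : (r < R0)%N -> (r' < R0)%N ->
    (k * r = k * r' %[mod T])%N -> r = r'.
  move=> rR rR' /eqP E; apply/eqP; apply: contraTT isT => rr'.
  have omrr' : (om ^+ k) ^+ r = (om ^+ k) ^+ r'.
    by rewrite -!exprM -(expr_mod _ omT) (eqP E) expr_mod.
  have lrr' : lam ^+ r != lam ^+ r' by apply: contraNneq rr' => /laminj ->.
  have := liouville_exp_sub R lam beta D r r' Hliou lrr'.
  have b1 (s : nat) : (s < R0)%N -> beta ^+ s <= U.
    move=> sR; rewrite (le_trans _ Hbeta)// ler_weXn2l//.
    by rewrite (leq_trans (ltnW sR))// leq_pmull.
  have l1 (s : nat) : (s < R0)%N -> cabs R (lam ^+ s - (om ^+ k) ^+ s) <= U * eps.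
    move=> sR; rewrite (le_trans (cabs_exp_sub _ _ _ _ lam1 omk1))//.
    rewrite ler_wpM2r// -HE ler_nat (leq_trans _ HLR)//.
    by rewrite (leq_trans (ltnW sR))// leq_pmull.
  have small : cabs R (lam ^+ r - lam ^+ r') <= 2 * U * eps.
    have -> : lam ^+ r - lam ^+ r' = (lam ^+ r - (om ^+ k) ^+ r) - (lam ^+ r' - (om ^+ k) ^+ r').
      by rewrite omrr'; ring.
    rewrite (le_trans (cabsB _ _ _))//.
    have := l1 r rR; have := l1 r' rR'; lra.
  have len : (beta ^+ r + beta ^+ r') ^+ D <= (U ^+ 2) ^+ D.
    have bp (s : nat) : 0 <= beta ^+ s by rewrite exprn_ge0//; lra.
    rewrite lerXn2r ?nnegrE ?addr_ge0 ?exprn_ge0 ?(ltW U0)//.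
    rewrite expr2 (le_trans (lerD (b1 r rR) (b1 r' rR')))//.
    by rewrite -mulr2n -mulr_natl ler_wpM2r//; lra.
  move=> ge1; exfalso.
  have : 1 <= 2 * U * eps * (U ^+ 2) ^+ D.
    rewrite (le_trans ge1)// ler_pM ?cabs_ge0//.
    by rewrite exprn_ge0// addr_ge0// exprn_ge0//; lra.
  have -> : 2 * U * eps * (U ^+ 2) ^+ D = 2 * eps * U ^+ (2 * D + 1).
    by rewrite -exprM exprD expr1; ring.
  have : eps * U ^+ (2 * D + 1) * U <= 1.
    rewrite -mulrA -exprSr (le_trans _ epsU)// ler_wpM2l// ler_weXn2l//.
  have q0 : 0 <= eps * U ^+ (2 * D + 1) by rewrite mulr_ge0 ?exprn_ge0 ?(ltW U0).
  move=> qU; have := le_trans (ler_wpM2l q0 U8) qU; rewrite -mulrA; lra.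
pose F r s := \sum_(x : 'I_I * 'I_L)
  (p x * ((k * r + s * T) ^_ x.1)%:Z)%:~R * lam ^+ (x.2 * r).
have MTB (r s : nat) : (r < R0)%N -> (s < S)%N -> (k * r + s * T <= T * B)%N.
  move=> rR sS; rewrite /B mulnDr [(s * T)%N]mulnC leq_add ?leq_mul// ltnW//.
have ffTB (r s : nat) (i : 'I_I) : (r < R0)%N -> (s < S)%N ->
    ((k * r + s * T) ^_ i)%:R <= (T * B)%:R ^+ I :> R.
  move=> rR sS; rewrite -natrX ler_nat (leq_trans (ffact_le_exp _ _))//.
  apply: (@leq_trans ((T * B) ^ i)).
    by case: (val i) => // j; rewrite leq_exp2r// MTB.
  by rewrite leq_pexp2l ?muln_gt0 ?T0// ltnW.
have pU x : `|p x|%:~R <= U :> R by rewrite -HE -[H%:R]/(H%:Z%:~R) ler_int.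
have sumU (G : 'I_I * 'I_L -> R) (g : R) : (forall x, G x <= U * ((T * B)%:R ^+ I * g)) ->
    0 <= g -> \sum_x G x <= U * U * g.
  move=> GU g0; apply: (@le_trans _ _ ((U * ((T * B)%:R ^+ I * g)) *+ (I * L))).
    have -> : (I * L)%N = #|{: 'I_I * 'I_L}| by rewrite card_prod !card_ord.
    by rewrite -sumr_const ler_sum.
  rewrite -mulr_natl.
  have -> : (I * L)%:R * (U * ((T * B)%:R ^+ I * g)) = ((I * L)%:R * (T * B)%:R ^+ I) * (U * g).
    by ring.
  by rewrite -[U * U * g]mulrA ler_wpM2r// mulr_ge0// ltW.
(* [F r s] is the value of the auxiliary polynomial at [(M, om^M)] plus the error of replacing
   [om^k] by [lam]. The contributions are [4 U^3] from the Newton coefficients, [2 U^2] from the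
   tail and [U^3] from the replacement. *)
have Fsmall r s : (r < R0)%N -> (s < S)%N -> cabs R (F r s) * U ^+ w <= 7 * U ^+ 3.
  move=> rR sS; pose M := (k * r + s * T)%N.
  have FE : F r s = \sum_x (p x)%:~R * ((M ^_ x.1)%:R * (om ^+ x.2) ^+ M)
    + \sum_x (p x)%:~R * ((M ^_ x.1)%:R * (lam ^+ (x.2 * r) - (om ^+ k) ^+ (x.2 * r))).
    rewrite -big_split/=; apply: eq_bigr => x _.
    have -> : (om ^+ x.2) ^+ M = (om ^+ k) ^+ (x.2 * r).
      rewrite -!exprM /M mulnDr exprD [(x.2 * (s * T))%N]mulnA mulnC.
      rewrite [X in _ * X = _]exprM [(_ ^+ _) ^+ T]exprAC omT expr1n mulr1.
      by congr (_ ^+ _); ring.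
    by rewrite intrM -[((M ^_ _)%:Z)%:~R]/((M ^_ _)%:R); ring.
  have part1 := pM M (MTB r s rR sS).
  have part2 : cabs R (\sum_x (p x)%:~R * ((M ^_ x.1)%:R *
      (lam ^+ (x.2 * r) - (om ^+ k) ^+ (x.2 * r)))) <= U * U * (U * eps).
    rewrite (le_trans (cabs_sum _ _ _ _ _))//; apply: sumU; last by rewrite mulr_ge0// ltW.
    move=> x; rewrite !cabsM cabs_int cabs_nat.
    apply: ler_pM; rewrite ?ler0z ?mulr_ge0 ?cabs_ge0//.
    by apply: ler_pM; rewrite ?cabs_ge0 ?ffTB// lamU.
  have part1' : (I + d)%:R * (4 * H%:R * W / N%:R) * U ^+ w <= 4 * U ^+ 3.
    rewrite HE NE.
    have -> : (I + d)%:R * (4 * U * W / U ^+ w) * U ^+ w = (I + d)%:R * (4 * U * W).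
      by field; rewrite gt_eqF.
    have IdU : (I + d)%:R <= U by rewrite -HE ler_nat.
    rewrite (@le_trans _ _ (U * (4 * U * U)))//; last first.
      by rewrite le_eqVlt; apply/orP; left; apply/eqP; ring.
    rewrite ler_pM ?mulr_ge0 ?(ltW U0)// ler_wpM2l// mulr_ge0// ltW//.
  have part1'' : H%:R * W * (2 / 4 ^+ d) * U ^+ w <= 2 * U ^+ 2.
    have -> : 4 ^+ d = U ^+ w * U ^+ w.
      rewrite -expr2 /U -!exprM /d (_ : 4 = 2 ^+ 2); last by ring.
      by rewrite -exprM; congr (_ ^+ _); ring.
    have -> : H%:R * W * (2 / (U ^+ w * U ^+ w)) * U ^+ w = 2 * (U * W) / U ^+ w.
      by rewrite HE; field; rewrite gt_eqF.
    rewrite ler_pdivrMr// (@le_trans _ _ (2 * U ^+ 2))//.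
      by rewrite ler_wpM2l// expr2 ler_wpM2l// ltW.
    by rewrite ler_peMr ?mulr_ge0 ?exprn_ge0 ?(ltW U0)// exprn_ege1.
  have part2' : U * U * (U * eps) * U ^+ w <= U ^+ 3.
    have -> : U * U * (U * eps) * U ^+ w = U ^+ 3 * (eps * U ^+ w) by ring.
    by rewrite ler_piMr ?exprn_ge0 ?(ltW U0).
  have U23 : U ^+ 2 <= U ^+ 3 by rewrite ler_weXn2l.
  rewrite FE.
  have : cabs R (\sum_x (p x)%:~R * ((M ^_ x.1)%:R * (om ^+ x.2) ^+ M)
    + \sum_x (p x)%:~R * ((M ^_ x.1)%:R * (lam ^+ (x.2 * r) - (om ^+ k) ^+ (x.2 * r))))
    <= (I + d)%:R * (4 * H%:R * W / N%:R) + H%:R * W * (2 / 4 ^+ d) + U * U * (U * eps).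
    by rewrite (le_trans (cabsD _ _ _))// lerD.
  move=> /(ler_wpM2r (ltW Uw0))/le_trans; apply.
  rewrite !mulrDl; lra.
(* A non-zero value would satisfy [|F| U^(3 D) >= 1]; with [w = 3 D + 5] the previous bound then
   gives [U^2 <= 7], whereas [U >= 8]. *)
have F0 r s : (r < R0)%N -> (s < S)%N -> F r s = 0.
  move=> rR sS; apply/eqP; apply: contraTT isT => F0.
  have := Hliou _ _ _ F0; rewrite -/(F r s).
  set len := \sum_x _ => ge1; exfalso.
  have len0 : 0 <= len by apply: sumr_ge0 => x _; rewrite mulr_ge0 ?exprn_ge0 ?ler0z.
  have lenU : len <= U ^+ 3.
    have -> : U ^+ 3 = U * U * U by ring.
    apply: sumU; last exact: ltW.
    move=> x; rewrite normrM intrM -mulrA.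
    apply: ler_pM; rewrite ?ler0z ?mulr_ge0 ?ler0z ?exprn_ge0//.
    apply: ler_pM; rewrite ?ler0z ?exprn_ge0//.
      by rewrite ger0_norm ?lez_nat// ffTB.
    rewrite (le_trans _ Hbeta)// ler_weXn2l// leq_mul// ltnW//.
  have lenD : len ^+ D <= U ^+ (3 * D).
    by rewrite exprM lerXn2r ?nnegrE ?exprn_ge0// ltW.
  have := Fsmall r s rR sS.
  have -> : U ^+ w = U ^+ (3 * D) * U ^+ 5 by rewrite /w exprD.
  have : 1 <= cabs R (F r s) * U ^+ (3 * D).
    by rewrite (le_trans ge1)// ler_wpM2l// cabs_ge0.
  rewrite mulrA; set Z := cabs R _ * _ => Z1.
  have -> : U ^+ 5 = U ^+ 3 * U ^+ 2 by rewrite -exprD.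
  have U3 : 0 < U ^+ 3 by rewrite exprn_gt0.
  rewrite mulrA mulrAC -[7 * _]/(7 * U ^+ 3) ler_pM2r//.
  have U2 : 8 <= U ^+ 2 by rewrite (le_trans U8)// expr2 ler_peMl// ltW.
  have Z0 : 0 <= Z by rewrite (le_trans ler01).
  move=> ZU; have := le_trans (ler_wpM2l Z0 U2) ZU; lra.
pose P : 'M[R[i]]_(I, L) := \matrix_(i, l) (p (i, l))%:~R.
have P0 : P = 0.
  apply: (zero_estimate _ I L S R0 T k lam P T0 _ kinj zeroc).
    by move=> r r' _ _; apply: laminj.
  move=> r s rR sS; rewrite -[RHS](F0 r s rR sS) /F pair_bigA/=.
  by apply: eq_bigr => -[i l] _; rewrite mxE/= intrM.
have /matrixP/(_ x0.1 x0.2) := P0; rewrite !mxE -surjective_pairing => /eqP.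
by rewrite intr_eq0 (negPf px0).
Qed.

(** * Choice of the parameters and the lower bound on the unit circle *)

Lemma exp_le_two_exp (d : nat) : exists q0 : nat, forall q, (q0 <= q)%N -> (q ^ d <= 2 ^ q)%N.
Proof.
exists (d.+1 ^ d.+1)%N => q dq.
have q0 : (0 < q)%N by rewrite (leq_trans _ dq)// expn_gt0.
rewrite -(leq_pmul2l q0) -expnS (leq_trans (_ : _ <= d.+1 ^ d.+1 * 2 ^ q)%N)//.
  have qx : (q <= d.+1 * (q %/ d.+1).+1)%N by rewrite mulnC ltnW// ltn_ceil.
  apply: (@leq_trans ((d.+1 * 2 ^ (q %/ d.+1)) ^ d.+1)).
    by rewrite leq_exp2r// (leq_trans qx)// leq_pmul2l// ltn_expl.
  by rewrite expnMn leq_pmul2l ?expn_gt0// -expnM leq_exp2l// leq_trunc_div.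
by rewrite leq_mul2r dq orbT.
Qed.

Lemma two_exp_bound (R : realType) (x : R) : exists m : nat, x <= 2 ^+ m.
Proof.
by exists (Num.bound x); rewrite ltW// upper_nthrootP.
Qed.

Lemma Bernoulli_ineq (R : realType) (x : R) (n : nat) :
  0 <= x -> 1 + n%:R * x <= (1 + x) ^+ n.
Proof.
move=> x0; elim: n => [|n IHn]; first by rewrite mul0r addr0 expr0.
rewrite exprS (le_trans _ (ler_wpM2l _ IHn)) ?addr_ge0//.
rewrite -natr1; have : 0 <= n%:R * x * x by rewrite !mulr_ge0.
lra.
Qed.

Lemma exists_exp_ge2 (R : realType) (x : R) : 1 < x ->
  exists2 h : nat, (0 < h)%N & 2 <= x ^+ h.
Proof.
move=> x1; exists (Num.bound (x - 1)^-1).+1 => //.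
have y0 : 0 < x - 1 by lra.
have := Bernoulli_ineq R (x - 1) (Num.bound (x - 1)^-1).+1 (ltW y0).
rewrite [1 + (x - 1)]addrC subrK; apply: le_trans; rewrite -[2]/(1 + 1 : R) lerD2l.
rewrite -ler_pdivrMr// mul1r -natr1 (@le_trans _ _ (Num.bound (x - 1)^-1)%:R)//; last lra.
by rewrite ltW// archi_boundP// invr_ge0 ltW.
Qed.

(* With [T <= 2 ^ q < 2 T], the choices [I = q^5], [L = q^2], [R0 = S = 2 q^4] *)
(* and [u] proportional to [q^6] satisfy all the constraints of *)
(* [no_close_root] once [q] is large. *)
Lemma unit_circle_eventually (R : realType) (lam : R[i]) (beta Lam : R) (D : nat) :
  liouville R lam beta D -> cabs R lam = 1 -> 1 <= beta ->
  (forall a, (0 < a)%N -> lam ^+ a != 1) -> 1 < Lam ->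
  exists T0 : nat, forall T, (T0 <= T)%N -> 1 <= Lam ^+ T * cabs R (lam ^+ T - 1).
Proof.
move=> Hliou lam1 beta1 nru Lam1.
have [m0 Hm0] := two_exp_bound R (expR 256).
have [b0 Hb0] := two_exp_bound R beta.
have [h h0 Hh] := exists_exp_ge2 R Lam Lam1.
have [Q7 HQ7] := exp_le_two_exp 7.
have [w wE] : exists w, w = (3 * D + 5)%N by eexists.
(* [2^(u0 q^6)] must dominate [e^(256 q^6)] (share [m0]), [beta^(2 q^6)] (share [2 b0]) and the
   polynomial factors of [W] (share 14). *)
have [u0 u0E] : exists u0, u0 = (m0 + 2 * b0 + 14)%N by eexists.
pose q0 := (Q7 + 2 + 2 * w.+1 * (1 + w * u0) + 2 * h * (w * u0 + 2))%N.
exists (2 ^ q0)%N => T T0T.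
rewrite leNgt; apply/negP => close.
pose q := up_log 2 T.
have T2q : (T <= 2 ^ q)%N by rewrite up_logP.
have qq0 : (q0 <= q)%N by rewrite -(leq_exp2l (m := 2))// (leq_trans T0T).
have q2 : (2 <= q)%N by rewrite (leq_trans _ qq0)// /q0; lia.
have q_gt0 : (0 < q)%N by rewrite (leq_trans _ q2).
have T_gt0 : (0 < T)%N by rewrite (leq_trans _ T0T)// expn_gt0.
have T1 : (1 < T)%N.
  by rewrite (leq_trans _ T0T)// -{1}(expn0 2) ltn_exp2l// /q0; lia.
have q2T : (2 ^ q < 2 * T)%N.
  have /andP[+ _] := up_log_bounds (isT : 1 < 2)%N T1.
  by rewrite -/q -(ltn_pmul2l (isT : 0 < 2)%N) -expnS prednK.
have qQ7 : (q ^ 7 <= 2 ^ q)%N by apply: HQ7; rewrite (leq_trans _ qq0)// /q0; lia.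
have q_two : (q <= 2 ^ q)%N by rewrite ltnW// ltn_expl.
pose u := (u0 * q ^ 6)%N.
have qA : (2 * w.+1 * (1 + w * u0) <= q)%N by rewrite (leq_trans _ qq0)// /q0; lia.
have qB : (2 * h * (w * u0 + 2) <= q)%N by rewrite (leq_trans _ qq0)// /q0; lia.
have u14 : (14 * q ^ 6 <= u)%N by rewrite leq_mul2r u0E leq_addl orbT.
have uq6 : (u0 * q <= u)%N by rewrite leq_mul2l -{1}(expn1 q) leq_pexp2l// orbT.
have q16 : (q <= q ^ 6)%N by rewrite -{1}(expn1 q) leq_pexp2l.
have q6 : (2 * q <= q ^ 6)%N.
  by rewrite expnS mulnC leq_pmul2l// (leq_trans q2)// -{1}(expn1 q) leq_pexp2l.
(* The left side has order [q^6], while [q^7 <= 2^q < 2 T]. As [Lam^h >= 2], this yields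
   [2^(w u + 2) <= Lam^T]; the extra factor 4 pays for the constant of [root_of_unity_near]. *)
have wu_le : (h * (w * u + 2) <= T)%N.
  rewrite -(leq_pmul2l (isT : 0 < 2)%N) ltnW// (leq_ltn_trans _ q2T)//.
  rewrite (leq_trans _ qQ7)// (leq_trans (_ : _ <= 2 * h * (w * u0 + 2) * q ^ 6)%N)//.
    rewrite mulnA -[leqRHS]mulnA leq_mul2l mulnDl /u mulnA leq_add2l.
    by rewrite leq_pmulr ?expn_gt0 ?q_gt0 ?orbT.
  by rewrite expnS leq_mul2r qB orbT.
have LamT : 2 ^+ (w * u + 2) <= Lam ^+ T.
  apply: (@le_trans _ _ ((Lam ^+ h) ^+ (w * u + 2))).
    by rewrite lerXn2r ?nnegrE// exprn_ge0//; lra.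
  by rewrite -exprM ler_weXn2l// ltW.
have eps0 := cabs_ge0 R (lam ^+ T - 1).
have close4 : cabs R (lam ^+ T - 1) * (2 ^+ (w * u) * 4) <= 1.
  have -> : 2 ^+ (w * u) * 4 = 2 ^+ (w * u + 2) :> R by rewrite exprD; congr (_ * _); ring.
  by rewrite (le_trans (ler_wpM2l eps0 LamT))// mulrC ltW.
have two1 : 1 <= 2 ^+ (w * u) :> R by rewrite exprn_ege1// ler1n.
have small : cabs R (lam ^+ T - 1) <= 2^-1.
  have : cabs R (lam ^+ T - 1) * 4 <= 1.
    rewrite (le_trans _ close4)// ler_wpM2l// ler_peMl//.
  lra.
have [om [k [omT om1 om_near kT lam_near]]] :=
  root_of_unity_near R lam T T_gt0 lam1 small.
have bigterm : (q ^ 5 * q ^ 2)%:R * (T * (2 * q ^ 4 + 2 * q ^ 4))%:R ^+ (q ^ 5)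
    * expR (64 * (q ^ 2 * (2 * q ^ 4 + 2 * q ^ 4))%:R) <= 2 ^+ u :> R.
  have e1 : expR (64 * (q ^ 2 * (2 * q ^ 4 + 2 * q ^ 4))%:R) <= 2 ^+ (m0 * q ^ 6) :> R.
    have -> : 64 * (q ^ 2 * (2 * q ^ 4 + 2 * q ^ 4))%:R = (q ^ 6)%:R * 256 :> R.
      by rewrite !(natrM, natrX, natrD); ring.
    by rewrite expRM_natl exprM lerXn2r ?nnegrE ?expR_ge0 ?exprn_ge0.
  have e2 : (q ^ 5 * q ^ 2 * (T * (2 * q ^ 4 + 2 * q ^ 4)) ^ (q ^ 5) <= 2 ^ (14 * q ^ 6))%N.
    have -> : (14 * q ^ 6 = 7 * q ^ 6 + 7 * q * q ^ 5)%N by rewrite -mulnA -expnS -mulnDl.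
    rewrite expnD leq_mul//.
      rewrite -expnD (leq_trans qQ7)// leq_exp2l//.
      by rewrite (leq_trans q16)// leq_pmull.
    rewrite expnM leq_exp2r ?expn_gt0 ?q_gt0//.
    apply: (@leq_trans (2 ^ q * (4 * 2 ^ (q * 4)))%N).
      rewrite leq_mul// -mulnDl leq_pmul2l// expnM leq_exp2r//.
    rewrite -[4%N]/(2 ^ 2)%N -!expnD leq_exp2l//.
    by move: q2; clear; lia.
  apply: (@le_trans _ _ (2 ^+ (14 * q ^ 6) * 2 ^+ (m0 * q ^ 6))).
    apply: ler_pM => //; rewrite ?expR_ge0 ?mulr_ge0 ?exprn_ge0//.
    by rewrite -!natrX -[leLHS]natrM ler_nat.
  rewrite -exprD ler_weXn2l ?ler1n// -mulnDl leq_mul2r u0E.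
  by rewrite addnC -addnA addnCA leq_addl orbT.
have betaU : beta ^+ (q ^ 2 * (2 * q ^ 4)) <= 2 ^+ u.
  apply: (@le_trans _ _ ((2 ^+ b0) ^+ (q ^ 2 * (2 * q ^ 4)))).
    by rewrite lerXn2r ?nnegrE//; lra.
  rewrite -exprM ler_weXn2l ?ler1n// /u u0E.
  have -> : (b0 * (q ^ 2 * (2 * q ^ 4)) = 2 * b0 * q ^ 6)%N by ring.
  by rewrite leq_mul2r addnAC leq_addl orbT.
have LR0 : (q ^ 2 * (2 * q ^ 4) <= 2 ^ u)%N.
  have -> : (q ^ 2 * (2 * q ^ 4) = 2 * q ^ 6)%N by ring.
  rewrite (leq_trans _ (ltnW (ltn_expl u (isT : 1 < 2)%N)))// (leq_trans _ u14)//.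
  by rewrite leq_mul2r orbT.
have IdU : (q ^ 5 + w * u <= 2 ^ u)%N.
  apply: (@leq_trans (w.+1 * u)).
    rewrite mulSn leq_add2r (leq_trans _ u14)//.
    by apply: (@leq_trans (q ^ 6)); [rewrite leq_pexp2l | rewrite leq_pmull].
  have wq : (w.+1 <= q)%N.
    rewrite (leq_trans _ qA)// -mulnA mulnC -mulnA leq_pmulr//.
  have u2 : (u <= 2 ^ (u0 + q * 6))%N.
    by rewrite expnD expnM leq_mul ?leq_exp2r// ltnW// ltn_expl.
  apply: (@leq_trans (2 ^ q * 2 ^ (u0 + q * 6))); first by rewrite leq_mul// (leq_trans wq).
  rewrite -expnD leq_exp2l//.
  apply: (@leq_trans (u0 * (2 * q))); last by rewrite leq_mul2l q6 orbT.
  have : (14 <= u0)%N by rewrite u0E leq_addl.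
  by move: q_gt0; clear; nia.
apply: (no_close_root R lam om beta D (q ^ 5) (q ^ 2) (2 * q ^ 4) (2 * q ^ 4) T k u
  Hliou lam1 beta1 nru omT om1 om_near kT T_gt0 _ _ _ _ bigterm betaU _ LR0).
- by rewrite muln_gt0 expn_gt0 q_gt0.
- by rewrite expn_gt0 q_gt0.
- by rewrite (leq_trans _ u14)// (leq_trans _ (leq_pmulr _ _)) ?expn_gt0 ?q_gt0.
- have q4 : (q ^ 4 <= 2 * q ^ 4 - q ^ 2)%N.
    by rewrite mul2n -addnn -addnBA ?leq_addr// leq_pexp2l.
  rewrite -expnD (leq_trans _ (leq_mul q4 q4))// -expnD ltn_exp2l//.
- by rewrite -wE.
- rewrite -wE -expnD (leq_trans (_ : _ <= 2 * w.+1 * (1 + w * u0) * q ^ 6)%N)//.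
    rewrite -[leqRHS]mulnA leq_mul2l mulnDl mul1n /u mulnA leq_add2r.
    by apply/orP; right; apply: leq_pexp2l.
  by rewrite (expnS q 6) leq_mul2r qA orbT.
- rewrite -wE (le_trans (ler_wpM2r _ lam_near))//.
  by rewrite -mulrA mulrCA [4 * _]mulrC.
Qed.

(** The eventual bound is applied to the square root of [Lam]; the other square root, raised to the
    power [T], supplies the factor [T] by Bernoulli's inequality. *)
Theorem unit_circle_lower_bound (R : realType) (lam : R[i]) (beta Lam : R) (D : nat) :
  liouville R lam beta D -> cabs R lam = 1 -> 1 <= beta ->
  (forall a, (0 < a)%N -> lam ^+ a != 1) -> 1 < Lam ->
  exists2 C : R, 0 < C &
    forall T, (0 < T)%N -> T%:R <= C * (Lam ^+ T * cabs R (lam ^+ T - 1)).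
Proof.
move=> Hliou lam1 beta1 nru Lam1.
have Lam0 : 0 < Lam by lra.
pose x := Num.sqrt Lam.
have x1 : 1 < x by rewrite -sqrtr1 ltr_sqrt.
have xx : x * x = Lam by rewrite -expr2 sqr_sqrtr// ltW.
have [T0 HT0] := unit_circle_eventually R lam beta x D Hliou lam1 beta1 nru x1.
pose f T := x ^+ T * cabs R (lam ^+ T - 1).
have f0 T : (0 < T)%N -> 0 < f T.
  move=> T_gt0; rewrite mulr_gt0 ?cabs_gt0 ?subr_eq0 ?nru// exprn_gt0//; lra.
have f_ge0 T : 0 <= f T by rewrite mulr_ge0 ?cabs_ge0 ?exprn_ge0//; lra.
(* Absorbs the finitely many [T < T0]; the term at [j = 0] is the inverse of zero, which is zero. *)
pose C := 1 + \sum_(j < T0) (f j)^-1.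
have C1 : 1 <= C by rewrite lerDl sumr_ge0// => j _; rewrite invr_ge0.
have Cf T : (0 < T)%N -> 1 <= C * f T.
  move=> T_gt0; have [TT0|/HT0 H] := ltnP T T0; last first.
    by apply: (le_trans H); rewrite -/(f T) -[leLHS]mul1r ler_wpM2r.
  rewrite -ler_pdivrMr ?f0// mul1r /C (bigD1 (Ordinal TT0))//= addrCA lerDl.
  by rewrite addr_ge0// sumr_ge0// => j _; rewrite invr_ge0.
exists (C / (x - 1)) => [|T T_gt0]; first by rewrite divr_gt0//; lra.
have x10 : 0 < x - 1 by lra.
have Tx : T%:R * (x - 1) <= x ^+ T.
  have := Bernoulli_ineq R (x - 1) T (ltW x10); rewrite [1 + (x - 1)]addrC subrK; lra.
rewrite mulrAC ler_pdivlMr// (le_trans Tx)//.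
have -> : C * (Lam ^+ T * cabs R (lam ^+ T - 1)) = x ^+ T * (C * f T).
  by rewrite /f -xx exprMn; ring.
by rewrite ler_peMr ?Cf// exprn_ge0//; lra.
Qed.

(** * Norms and eigenvalues of the multiplication matrix *)

Lemma vnorm0 (R : realType) (n : nat) (nrm : 'cV[R]_n -> R) :
  is_vnorm nrm -> nrm 0 = 0.
Proof. by case=> _ nZ _; rewrite -(scale0r (0 : 'cV_n)) nZ normr0 mul0r. Qed.

Lemma vnormN (R : realType) (n : nat) (nrm : 'cV[R]_n -> R) (u : 'cV[R]_n) :
  is_vnorm nrm -> nrm (- u) = nrm u.
Proof. by case=> _ nZ _; rewrite -scaleN1r nZ normrN normr1 mul1r. Qed.

Lemma vnorm_ge0 (R : realType) (n : nat) (nrm : 'cV[R]_n -> R) (u : 'cV[R]_n) :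
  is_vnorm nrm -> 0 <= nrm u.
Proof.
move=> hn; have [nD _ _] := hn; have := nD u (- u).
by rewrite subrr (vnorm0 _ _ _ hn) (vnormN _ _ _ _ hn) -mulr2n pmulrn_lge0.
Qed.

Lemma vnorm_sum (R : realType) (n : nat) (nrm : 'cV[R]_n -> R) (J : Type)
    (r : seq J) (P : pred J) (F : J -> 'cV[R]_n) :
  is_vnorm nrm -> nrm (\sum_(j <- r | P j) F j) <= \sum_(j <- r | P j) nrm (F j).
Proof.
move=> hn; have [nD _ _] := hn.
elim/big_ind2: _ => [|x a y b xa yb|//]; first by rewrite (vnorm0 _ _ _ hn).
by rewrite (le_trans (nD _ _))// lerD.
Qed.

Lemma vnorm_le_coord (R : realType) (n : nat) (nrm : 'cV[R]_n -> R) :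
  is_vnorm nrm -> exists2 c : R, 0 < c &
    forall (u : 'cV[R]_n) (m : R), 0 <= m -> (forall i, `|u i 0| <= m) -> nrm u <= c * m.
Proof.
move=> hn; have [nD nZ _] := hn.
have s0 : 0 <= \sum_i nrm (delta_mx i 0) by apply: sumr_ge0 => i _; apply: vnorm_ge0.
exists (1 + \sum_i nrm (delta_mx i 0)) => [|u m m0 um]; first by rewrite ltr_pwDl.
rewrite {1}(matrix_sum_delta u) (le_trans (vnorm_sum _ _ _ _ _ _ _ hn))//.
apply: (@le_trans _ _ (\sum_i m * nrm (delta_mx i 0))).
  apply: ler_sum => i _; rewrite big_ord1 nZ ler_wpM2r//; exact: vnorm_ge0.
by rewrite -mulr_sumr mulrC ler_wpM2r// lerDr.
Qed.

(** Equivalence of norms: [nrm] is continuous, so it attains a minimum on the compact unit sphere of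
    the maximum norm, and this minimum is positive by definiteness. *)
Lemma coord_le_vnorm (R : realType) (n : nat) (nrm : 'cV[R]_n -> R) :
  is_vnorm nrm -> exists2 c : R, 0 < c &
    forall (u : 'cV[R]_n) i, `|u i 0| <= c * nrm u.
Proof.
move=> hn; have [nD nZ n0] := hn.
have [K K0 HK] := vnorm_le_coord R n nrm hn.
pose f (v : 'rV[R]_n) := nrm v^T.
pose A := [set v : 'rV[R]_n | `|v| = 1]%classic.
have coordle (v : 'rV[R]_n) i : `|v 0 i| <= `|v|.
  rewrite [leRHS]/Num.Def.normr/= mx_normrE.
  by apply/bigmax_geP; right; exists (0, i).
have fK v w : `|f v - f w| <= K * `|v - w|.
  have half (x y : 'rV[R]_n) : f x - f y <= K * `|x - y|.
    rewrite lerBlDr -[X in f X](subrK y) /f linearD (le_trans (nD _ _))// lerD2r.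
    by apply: HK => // i; rewrite mxE coordle.
  by rewrite ler_norml half andbT lerNl opprB distrC half.
have fcont : continuous f.
  move=> v; apply/(@cvgrPdist_lt _ _ _ (nbhs v)) => e e0.
  near=> w; rewrite (le_lt_trans (fK _ _))//.
  rewrite mulrC -ltr_pdivlMr//; near: w.
  by apply: (@cvgr_dist_lt _ _ _ _ _ id v) => //; rewrite divr_gt0.
have Acpt : compact A.
  apply: bounded_closed_compact.
    exists 1; split=> // x x1 v /= ->; exact: ltW.
  change A with ((fun v : 'rV[R]_n => `|v|) @^-1` [set 1])%classic.
  apply: closed_comp; last exact: closed_eq.
  by move=> v _; apply: norm_continuous.
(* The sphere is empty only in dimension zero. *)
have [A0|A0] := pselect (A !=set0)%classic; last first.
  exists 1 => // u i; have [->|u0] := eqVneq u 0.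
    by rewrite mxE normr0 (vnorm0 _ _ _ hn) mulr0.
  have ut0 : `|u^T| != 0 by rewrite normr_eq0 trmx_eq0.
  exfalso; apply: A0; exists (`|u^T|^-1 *: u^T) => /=.
  by rewrite /A/= normrZ normfV normr_id mulVf.
have [c /set_mem cA cmin] := EVT_min_rV A0 Acpt (continuous_subspaceT fcont).
have fc0 : 0 < f c.
  rewrite lt_def (vnorm_ge0 _ _ _ _ hn) andbT; apply/eqP => /n0 /(congr1 trmx).
  rewrite trmxK trmx0 => c0; move: cA; rewrite /A/= c0 normr0 => /eqP.
  by rewrite eq_sym oner_eq0.
exists (f c)^-1 => [|u i]; first by rewrite invr_gt0.
rewrite mulrC ler_pdivlMr//.
have [->|u0] := eqVneq u 0; first by rewrite mxE normr0 mul0r (vnorm0 _ _ _ hn).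
have ut0 : 0 < `|u^T| by rewrite normr_gt0 trmx_eq0.
have := cmin (`|u^T|^-1 *: u^T); rewrite /f linearZ/= trmxK nZ normfV normr_id.
have -> : (`|u^T|^-1 *: u^T) \in A.
  by apply/mem_set => /=; rewrite /A/= normrZ normfV normr_id mulVf// gt_eqF.
move=> /(_ isT); rewrite mulrC ler_pdivlMr// => H.
rewrite (le_trans _ H)// mulrC ler_wpM2l ?(ltW fc0)//.
by have := coordle u^T i; rewrite mxE.
Unshelve. all: by end_near.
Qed.

(** Equivalence of norms shows that the set defining [op_norm] is bounded, so that its [sup] is a
    genuine upper bound; homogeneity does the rest. *)
Lemma op_norm_le (R : realType) (n : nat) (nrm : 'cV[R]_n -> R) (A : 'M[R]_n)
    (u : 'cV[R]_n) :
  is_vnorm nrm -> nrm (A *m u) <= op_norm nrm A * nrm u.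
Proof.
move=> hn; have [nD nZ n0] := hn.
have [K K0 HK] := vnorm_le_coord R n nrm hn.
have [c c0 Hc] := coord_le_vnorm R n nrm hn.
pose S := [set nrm (A *m u) | u in [set u : 'cV[R]_n | nrm u <= 1]]%classic.
have ubS : has_ubound S.
  exists (K * (\sum_i \sum_j `|A i j| * c)) => _ [v v1 <-]; apply: HK => [|i].
    by do 2 apply: sumr_ge0 => ? _; rewrite mulr_ge0// ltW.
  rewrite mxE (le_trans (ler_norm_sum _ _ _))//.
  apply: (@le_trans _ _ (\sum_j `|A i j| * c)).
    apply: ler_sum => j _; rewrite normrM ler_wpM2l// (le_trans (Hc v j))//.
    by rewrite ler_piMr// ltW.
  rewrite [leRHS](bigD1 i)//= lerDl sumr_ge0// => k _.
  by rewrite sumr_ge0// => j _; rewrite mulr_ge0// ltW.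
have [->|u0] := eqVneq u 0; first by rewrite mulmx0 (vnorm0 _ _ _ hn) mulr0.
have nu0 : 0 < nrm u.
  by rewrite lt_def (vnorm_ge0 _ _ _ _ hn) andbT; apply: contra u0 => /eqP/n0 ->.
rewrite -ler_pdivrMr//.
have -> : nrm (A *m u) / nrm u = nrm (A *m ((nrm u)^-1 *: u)).
  by rewrite -scalemxAr nZ normfV (gtr0_norm nu0) mulrC.
apply: (ub_le_sup ubS); exists ((nrm u)^-1 *: u) => //=.
by rewrite nZ normfV (gtr0_norm nu0) mulVf// gt_eqF.
Qed.

Lemma op_norm_ge0 (R : realType) (n : nat) (nrm : 'cV[R]_n -> R) (A : 'M[R]_n) :
  is_vnorm nrm -> 0 <= op_norm nrm A.
Proof.
move=> hn; rewrite /op_norm; set S := image _ _.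
have S0 : S 0 by exists 0; rewrite /= ?mulmx0 (vnorm0 _ _ _ hn).
have [ubS|nubS] := pselect (has_ubound S); first exact: (ub_le_sup ubS).
by rewrite sup_out// => -[_ /nubS].
Qed.

Lemma op_norm_powM (R : realType) (n : nat) (nrm : 'cV[R]_n -> R) (A : 'M[R]_n)
    (j : nat) (u : 'cV[R]_n) :
  is_vnorm nrm -> nrm (iter j (mulmx A) u) <= op_norm nrm A ^+ j * nrm u.
Proof.
move=> hn; elim: j => [|j IHj]; first by rewrite mul1r.
rewrite iterS (le_trans (op_norm_le _ _ _ _ _ hn))// exprS -mulrA.
by rewrite ler_wpM2l// op_norm_ge0.
Qed.

(* The hypothesis says that [Q[A]] is a field. *)
Lemma mxminpoly_separable (n' : nat) (A : 'M[rat]_n'.+1) :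
  (forall q : {poly rat}, horner_mx A q = 0 \/ \det (horner_mx A q) != 0) ->
  separable_poly (mxminpoly A).
Proof.
move=> alt; set p := mxminpoly A.
have p0 : p != 0 by apply/monic_neq0/mxminpoly_monic.
have pA : horner_mx A p = 0 by apply: mx_root_minpoly.
have cofactor1 (a c : {poly rat}) : p = a * c -> horner_mx A a = 0 -> size c = 1%N.
  move=> pE /mxminpoly_min pa.
  have [a0 c0] : a != 0 /\ c != 0 by apply/andP; rewrite -negb_or -mulf_eq0 -pE.
  have := dvdp_leq a0 pa; rewrite -/p pE size_mul//.
  have : (0 < size c)%N by rewrite lt0n size_poly_eq0.
  have : (0 < size a)%N by rewrite lt0n size_poly_eq0.
  by case: (size a) (size c) => [|m] [|[|k]] // _ _; rewrite !addnS /= ltnNge leq_addr.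
have size1_coprime (u v : {poly rat}) : size v = 1%N -> coprimep u v.
  by move=> /eqP; rewrite size_poly_eq1 => /eqp_coprimepr ->; rewrite coprimep1.
apply/separable_polyP; split=> [u v /dvdpP[w pE]|u _ szu]; last first.
  by rewrite -size_poly_eq0 polyorder.size_deriv -lt0n; case: (size u) szu => [|[]].
(* In [p = w u v] one factor must annihilate [A], since otherwise the product would be invertible;
   by minimality the other two factors are constants. *)
have [wuv0|] : horner_mx A (w * u * v) = 0 \/ \det (horner_mx A (w * u * v)) != 0.
- exact: alt.
- have size_dvd (x c : {poly rat}) : (x %| c)%R -> size c = 1%N -> size x = 1%N.
    move=> xc szc; have c0 : c != 0 by rewrite -size_poly_eq0 szc.
    apply/eqP; rewrite eqn_leq -{1}szc dvdp_leq// lt0n size_poly_eq0.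
    by apply: contraTneq xc => ->; rewrite dvd0p.
  have [w0|dw] := alt w.
    have := cofactor1 w (u * v) pE w0.
    by move=> /(size_dvd v _ (dvdp_mull _ (dvdpp _)))/size1_coprime.
  have [u0|du] := alt u.
    have := cofactor1 u (w * v); rewrite mulrCA -pE => /(_ erefl u0).
    by move=> /(size_dvd v _ (dvdp_mull _ (dvdpp _)))/size1_coprime.
  have [v0|dv] := alt v.
    have := cofactor1 v (w * u); rewrite [v * _]mulrC -mulrA -pE => /(_ erefl v0).
    by move=> /(size_dvd u _ (dvdp_mull _ (dvdpp _)))/(size1_coprime v);
      rewrite coprimep_sym.
  have : \det (horner_mx A (w * u * v)) != 0.
    by rewrite !rmorphM/= !det_mulmx !mulf_neq0.
  by rewrite wuv0 det0 eqxx.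
- by rewrite -mulrA -pE pA det0 eqxx.
Qed.

(** Separability survives extension of scalars, so over [R[i]] the minimal polynomial is a product
    of distinct linear factors. *)
Lemma rational_mx_diagonalizable (R : realType) (n' : nat) (A : 'M[rat]_n'.+1) :
  (forall q : {poly rat}, horner_mx A q = 0 \/ \det (horner_mx A q) != 0) ->
  exists (P : 'M[R[i]]_n'.+1) (d : 'rV[R[i]]_n'.+1),
    P \in unitmx /\ P *m map_mx ratr A = diag_mx d *m P.
Proof.
move=> /mxminpoly_separable sep.
pose AC : 'M[R[i]]_n'.+1 := map_mx ratr A.
have [rs rsE] := closed_field_poly_normal (mxminpoly AC).
rewrite (monicP (mxminpoly_monic _)) scale1r in rsE.
have rsu : uniq rs.
  by rewrite -separable_prod_XsubC -rsE mxminpoly_map separable_map.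
have /diagonalizableP[P Punit /similar_diagPex[d /(similarP Punit) PA]] :
    exists2 rs : seq R[i], uniq rs & mxminpoly AC %| \prod_(x <- rs) ('X - x%:P).
  by exists rs; rewrite -?rsE.
by exists P, d.
Qed.

Lemma diag_horner (F : fieldType) (n' : nat) (A P : 'M[F]_n'.+1) (d : 'rV[F]_n'.+1)
    (q : {poly F}) :
  P \in unitmx -> P *m A = diag_mx d *m P ->
  P *m horner_mx A q = diag_mx (\row_i q.[d 0 i]) *m P.
Proof.
move=> Punit PA; have -> : A = invmx P *m diag_mx d *m P.
  by rewrite -mulmxA -PA mulKmx.
rewrite horner_mx_uconjC// horner_mx_diag !mulmxA mulmxV// mul1mx.
by congr (diag_mx _ *m _); apply/rowP => i; rewrite !mxE.
Qed.

(** The integer matrix [q(A)] has determinant the product of the values [q(d_j)]. If one value is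
    non-zero, then [q(A)] is non-zero, hence invertible, and its determinant has absolute value at
    least 1. The remaining [n'] factors, counted with multiplicity, are bounded trivially. *)
Lemma eigenvalue_liouville (R : realType) (n' : nat) (A : 'M[int]_n'.+1)
    (AQ := map_mx intr A : 'M[rat]_n'.+1)
    (P : 'M[R[i]]_n'.+1) (d : 'rV[R[i]]_n'.+1) (beta : R) :
  (forall q : {poly rat}, horner_mx AQ q = 0 \/ \det (horner_mx AQ q) != 0) ->
  P \in unitmx -> P *m map_mx ratr AQ = diag_mx d *m P ->
  1 <= beta -> (forall i, cabs R (d 0 i) <= beta) ->
  forall i, liouville R (d 0 i) beta n'.
Proof.
move=> alt Punit PA beta1 dbeta i X c e.
pose q : {poly int} := \sum_x (c x)%:P * 'X^(e x).
pose M := horner_mx A q.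
pose val_ j := \sum_x (c x)%:~R * d 0 j ^+ e x.
have qC j : (map_poly intr q).[d 0 j] = val_ j.
  rewrite rmorph_sum horner_sum; apply: eq_bigr => x _.
  by rewrite rmorphM/= map_polyC map_polyXn !hornerE.
have MQ : map_mx intr M = horner_mx AQ (map_poly intr q) by rewrite map_horner_mx.
have ACE : map_mx ratr AQ = map_mx intr A :> 'M[R[i]]_n'.+1.
  by apply/matrixP => j k; rewrite !mxE ratr_int.
have MC : P *m map_mx intr M = diag_mx (\row_j val_ j) *m P.
  rewrite map_horner_mx -ACE (diag_horner _ _ _ _ _ _ Punit PA); congr (diag_mx _ *m _).
  by apply/rowP => j; rewrite !mxE qC.
have detM : (\det M)%:~R = \prod_j val_ j :> R[i].
  have := congr1 determinant MC; rewrite !det_mulmx det_diag [RHS]mulrC.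
  rewrite det_map_mx => /mulfI ->; last by rewrite -unitfE -unitmxE.
  by apply: eq_bigr => j _; rewrite mxE.
rewrite -/(val_ i) => vali.
have [M0|dM] := alt (map_poly intr q).
  have : map_mx intr M = 0 :> 'M[R[i]]_n'.+1.
    have : M = 0.
      apply/matrixP => j k; rewrite mxE; apply/eqP; rewrite -(intr_eq0 rat).
      by have /matrixP/(_ j k) := MQ; rewrite M0 !mxE => ->.
    by move=> ->; rewrite map_mx0.
  move=> MC0; move: MC; rewrite MC0 mulmx0 => /esym/(congr1 (mulmx^~ (invmx P))).
  rewrite mulmxK// mul0mx => /matrixP/(_ i i); rewrite !mxE eqxx mulr1n => val0.
  by rewrite val0 eqxx in vali.
have dM1 : 1 <= cabs R (\prod_j val_ j).
  rewrite -detM cabs_int ler1z -gtz0_ge1 normr_gt0.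
  by apply: contra dM => /eqP dM0; rewrite -MQ det_map_mx dM0.
rewrite (le_trans dM1)// (bigD1 i)//= cabsM ler_wpM2l ?cabs_ge0// cabs_prod.
set len := \sum_x _.
have len0 : 0 <= len.
  by apply: sumr_ge0 => x _; rewrite mulr_ge0 ?ler0z ?exprn_ge0//; lra.
apply: (@le_trans _ _ (\prod_(j < n'.+1 | j != i) len)).
  apply: ler_prod => j _; rewrite cabs_ge0/=.
  rewrite (le_trans (cabs_sum _ _ _ _ _))//; apply: ler_sum => x _.
  rewrite cabsM cabs_int cabsX ler_wpM2l ?ler0z//.
  by rewrite lerXn2r ?nnegrE ?cabs_ge0//; lra.
by rewrite prodr_const cardC1 card_ord.
Qed.

(* Otherwise the powers of [A] would be bounded integer matrices. *)
Lemma op_norm_gt1 (R : realType) (n' : nat) (A : 'M[int]_n'.+1)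
    (nrm : 'cV[R]_n'.+1 -> R) :
  is_vnorm nrm -> (forall a b, (a < b)%N -> A ^+ a != A ^+ b) ->
  1 < op_norm nrm (map_mx intr A).
Proof.
move=> hn Ainj; rewrite ltNge; apply/negP => Lam1.
pose AR : 'M[R]_n'.+1 := map_mx intr A.
have [c c0 Hc] := coord_le_vnorm R _ nrm hn.
pose b : R := \sum_k c * nrm (delta_mx k 0).
have [B bB] := two_exp_bound R b; pose m := (2 ^ B)%N.
have AXE j : AR ^+ j = map_mx intr (A ^+ j).
  by rewrite -(rmorphXn (map_mx (intr : int -> R))).
(* Entries are coordinates of images of basis vectors, and powers of [A] do not increase [nrm] when
   the operator norm is at most 1. *)
have entry j i k : `|(A ^+ j) i k| <= m%:Z.
  rewrite -(ler_int R) intr_norm.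
  have -> : ((A ^+ j) i k)%:~R = (AR ^+ j *m (delta_mx k 0 : 'cV_n'.+1)) i 0 :> R.
    by rewrite -colE mxE AXE mxE.
  rewrite (le_trans (Hc _ _))//.
  have -> : AR ^+ j *m delta_mx k 0 = iter j (mulmx AR) (delta_mx k 0) :> 'cV_n'.+1.
    by elim: j => [|j IHj]; rewrite ?mul1mx// exprS -mulmxA IHj.
  apply: (@le_trans _ _ (c * nrm (delta_mx k 0))).
    rewrite ler_wpM2l ?(ltW c0)// (le_trans (op_norm_powM _ _ _ _ _ _ hn))//.
    by rewrite ler_piMl ?vnorm_ge0// exprn_ile1// op_norm_ge0.
  rewrite (le_trans _ (le_trans bB _))//; last by rewrite -natrX.
  rewrite /b (bigD1 k)//= lerDl sumr_ge0// => l _.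
  by rewrite mulr_ge0 ?vnorm_ge0// ltW.
pose T : finType := 'M['I_(2 * m).+1]_n'.+1.
pose f (j : 'I_#|T|.+1) : T := \matrix_(i, k) inord `|(A ^+ j) i k + m%:Z|.
have /leq_card : injective f.
  suff H j k : f j = f k -> A ^+ j = A ^+ k.
    move=> j k /H E; apply/val_inj; case: (ltngtP j k) => // /Ainj; rewrite E eqxx//.
  move=> /matrixP fE; apply/matrixP => i l.
  have := congr1 val (fE i l); rewrite !mxE.
  have := entry j i l; have := entry k i l.
  set x := (A ^+ j) i l; set y := (A ^+ k) i l => ym xm.
  by rewrite /= !inordK; lia.
by rewrite card_ord ltnn.
Qed.

(** Off the unit circle the geometric sum is [| |lam|^T - 1 | / | |lam| - 1 |], which is at most
    [|lam^T - 1| / | |lam| - 1 |]; on the circle the sum is [T]. *)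
Lemma sum_exp_le (R : realType) (lam : R[i]) (beta Lam : R) (D : nat) :
  liouville R lam beta D -> 1 <= beta ->
  (forall a, (0 < a)%N -> lam ^+ a != 1) -> 1 < Lam ->
  exists2 C : R, 0 < C & forall T, (0 < T)%N ->
    \sum_(j < T) cabs R lam ^+ j <= C * (Lam ^+ T * cabs R (lam ^+ T - 1)).
Proof.
move=> Hliou beta1 nru Lam1.
have [lam1|lam1] := eqVneq (cabs R lam) 1.
  have [C C0 HC] := unit_circle_lower_bound R lam beta Lam D Hliou lam1 beta1 nru Lam1.
  exists C => // T T0; rewrite (le_trans _ (HC T T0))//.
  under eq_bigr do rewrite lam1 expr1n.
  by rewrite sumr_const card_ord.
have x0 : 0 < `|cabs R lam - 1| by rewrite normr_gt0 subr_eq0.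
exists `|cabs R lam - 1|^-1 => [|T T0]; first by rewrite invr_gt0.
rewrite mulrC ler_pdivlMr//.
have s0 : 0 <= \sum_(j < T) cabs R lam ^+ j.
  by apply: sumr_ge0 => j _; rewrite exprn_ge0 ?cabs_ge0.
rewrite -[X in X * _](ger0_norm s0) mulrC -normrM -subrX1.
have Lam_ge1 : 1 <= Lam ^+ T by rewrite exprn_ege1// ltW.
apply: (@le_trans _ _ (cabs R (lam ^+ T - 1))); last by rewrite ler_peMl ?cabs_ge0.
have := cabs_sub_ge R (lam ^+ T) 1; have := cabs_sub_ge R 1 (lam ^+ T).
rewrite [cabs R (1 - _)]cabs_subC cabs1 cabsX => H1 H2.
by rewrite ler_norml H2 andbT lerNl opprB.
Qed.

(** In the eigenbasis the equation decouples: [w = P u] satisfies [w_i (1 - d_i^T) = \sum_(j < T)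
    d_i^j (P v_j)_i], and [sum_exp_le] bounds each [w_i]. Going back by [invmx P] costs only a
    constant. *)
Lemma periodic_point_bound (R : realType) (n' : nat) (A : 'M[int]_n'.+1)
    (AQ := map_mx intr A : 'M[rat]_n'.+1) (AR := map_mx intr A : 'M[R]_n'.+1)
    (nrm : 'cV[R]_n'.+1 -> R) (Lam : R) :
  (forall q : {poly rat}, horner_mx AQ q = 0 \/ \det (horner_mx AQ q) != 0) ->
  (forall a b, (a < b)%N -> A ^+ a != A ^+ b) ->
  is_vnorm nrm -> 1 < Lam ->
  exists2 C : R, 0 < C &
    forall (T : nat) (u : 'cV[R]_n'.+1) (v : nat -> 'cV[R]_n'.+1) (B : R),
      (0 < T)%N -> 0 <= B -> (forall j, nrm (v j) <= B) ->
      u - AR ^+ T *m u = \sum_(j < T) AR ^+ j *m v j ->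
      nrm u <= C * B * Lam ^+ T.
Proof.
move=> alt Ainj hn Lam1.
have [P [d [Punit PA]]] := rational_mx_diagonalizable R n' AQ alt.
pose beta := 1 + \sum_i cabs R (d 0 i).
have s0 : 0 <= \sum_i cabs R (d 0 i) by apply: sumr_ge0 => i _; apply: cabs_ge0.
have beta1 : 1 <= beta by rewrite lerDl.
have dbeta i : cabs R (d 0 i) <= beta.
  rewrite /beta (bigD1 i)//= addrCA lerDl addr_ge0// sumr_ge0// => j _.
  exact: cabs_ge0.
have liou := eigenvalue_liouville R n' A P d beta alt Punit PA beta1 dbeta.
pose AC : 'M[R[i]]_n'.+1 := map_mx ratr AQ.
have PAX a : P *m AC ^+ a = diag_mx (\row_i d 0 i ^+ a) *m P.
  have := diag_horner _ _ _ _ _ 'X^a Punit PA.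
  rewrite rmorphXn/= horner_mx_X => ->; congr (diag_mx _ *m _).
  by apply/rowP => i; rewrite !mxE hornerXn.
(* If an eigenvalue were a root of unity, [A^a - 1] would be singular, hence zero by [alt], against
   [Ainj]. *)
have nru i a : (0 < a)%N -> d 0 i ^+ a != 1.
  move=> a0; apply/eqP => da.
  have [AXa|dAXa] := alt ('X^a - 1).
    have /eqP := Ainj 0%N a a0; apply; rewrite expr0; apply/esym.
    have AQa : AQ ^+ a = 1.
      apply/eqP; rewrite -subr_eq0; move: AXa.
      by rewrite rmorphB rmorphXn/= horner_mx_X rmorph1 => ->.
    apply/matrixP => j k; apply: (@intr_inj rat).
    have /matrixP/(_ j k) : map_mx intr (A ^+ a) = AQ ^+ a.
      exact: (rmorphXn (map_mx (intr : int -> rat))).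
    by rewrite AQa !mxE rmorph_nat.
  move: dAXa; rewrite rmorphB rmorphXn/= horner_mx_X rmorph1 => /eqP; apply.
  apply: (fmorph_inj (ratr : {rmorphism rat -> R[i]})); rewrite rmorph0 -det_map_mx.
  have ACa : map_mx ratr (AQ ^+ a) = AC ^+ a.
    exact: (rmorphXn (map_mx (ratr : rat -> R[i]))).
  rewrite map_mxB map_mx1 ACa.
  have detP : \det P != 0 by rewrite -unitfE -unitmxE.
  apply: (mulfI detP); rewrite mulr0 -det_mulmx mulmxBr mulmx1 PAX.
  rewrite -{2}[P]mul1mx -mulmxBl det_mulmx -[1%:M]diag_const_mx -linearB/= det_diag.
  by rewrite (bigD1 i)//= !mxE da subrr !mul0r.
have /choice[C HC] : forall i, exists C : R, 0 < C /\ forall T, (0 < T)%N ->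
    \sum_(j < T) cabs R (d 0 i) ^+ j <= C * (Lam ^+ T * cabs R (d 0 i ^+ T - 1)).
  move=> i; have [C C0 HC] := sum_exp_le R (d 0 i) beta Lam n' (liou i) beta1 (nru i) Lam1.
  by exists C.
have [c c0 Hc] := coord_le_vnorm R _ nrm hn.
have [K K0 HK] := vnorm_le_coord R _ nrm hn.
pose Ps i := \sum_k cabs R (P i k).
have Ps0 i : 0 <= Ps i by apply: sumr_ge0 => k _; apply: cabs_ge0.
pose S := \sum_k \sum_i cabs R (invmx P k i) * (C i * (Ps i * c)).
have S0 : 0 <= S.
  apply: sumr_ge0 => k _; apply: sumr_ge0 => i _.
  by rewrite !mulr_ge0 ?cabs_ge0 ?Ps0 ?(ltW c0)//; have [/ltW] := HC i.
exists (K * (1 + S)) => [|T u v B T0 B0 vB uE]; first by rewrite mulr_gt0// ltr_pwDl.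
pose rc : {rmorphism R -> R[i]} := real_complex R.
have [w wdef] : exists w, w = P *m map_mx rc u by eexists.
have ACR : AC = map_mx rc AR.
  by apply/matrixP => i k; rewrite !mxE ratr_int rmorph_int.
have ACX a : map_mx rc (AR ^+ a) = AC ^+ a by rewrite ACR -(rmorphXn (map_mx rc)).
have wE i : w i 0 * (1 - d 0 i ^+ T) = \sum_(j < T) d 0 i ^+ j * (P *m map_mx rc (v j)) i 0.
  have := congr1 (fun z => (P *m map_mx rc z) i 0) uE.
  rewrite map_mxB map_mxM ACX mulmxBr mulmxA PAX -mulmxA -wdef.
  rewrite mul_diag_mx [LHS]mxE [X in _ + X]mxE [X in _ - X]mxE [X in X * w i 0]mxE => H.
  transitivity (w i 0 - d 0 i ^+ T * w i 0); first by rewrite mulrBr mulr1 [w i 0 * _]mulrC.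
  rewrite [LHS]H map_mx_sum mulmx_sumr summxE; apply: eq_bigr => j _.
  by rewrite map_mxM ACX mulmxA PAX -mulmxA mul_diag_mx !mxE.
have vP i j : cabs R ((P *m map_mx rc (v j)) i 0) <= Ps i * c * B.
  rewrite mxE (le_trans (cabs_sum _ _ _ _ _))// /Ps !mulr_suml.
  apply: ler_sum => k _; rewrite cabsM mxE cabs_real -mulrA ler_wpM2l ?cabs_ge0//.
  by rewrite (le_trans (Hc _ _))// ler_wpM2l// ltW.
have Lam0 : 0 <= Lam ^+ T by rewrite exprn_ge0//; lra.
have wB i : cabs R (w i 0) <= C i * (Ps i * c) * (B * Lam ^+ T).
  have [C0 HCi] := HC i.
  have q0 : 0 < cabs R (d 0 i ^+ T - 1) by rewrite cabs_gt0 subr_eq0 nru.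
  rewrite -(ler_pM2r q0) [X in _ * X <= _]cabs_subC -cabsM wE.
  rewrite (le_trans (cabs_sum _ _ _ _ _))//.
  apply: (@le_trans _ _ (\sum_(j < T) cabs R (d 0 i) ^+ j * (Ps i * c * B))).
    by apply: ler_sum => j _; rewrite cabsM cabsX ler_wpM2l ?exprn_ge0 ?cabs_ge0.
  rewrite -mulr_suml (le_trans (ler_wpM2r _ (HCi T T0)))//.
    by rewrite !mulr_ge0// ltW.
  by rewrite le_eqVlt; apply/orP; left; apply/eqP; ring.
have uB k : `|u k 0| <= S * (B * Lam ^+ T).
  rewrite -cabs_real; have -> : (u k 0)%:C%C = (invmx P *m w) k 0.
    by rewrite wdef mulKmx// mxE.
  rewrite mxE (le_trans (cabs_sum _ _ _ _ _))// /S mulr_suml.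
  apply: (@le_trans _ _ (\sum_i cabs R (invmx P k i) * (C i * (Ps i * c)) * (B * Lam ^+ T))).
    by apply: ler_sum => i _; rewrite cabsM -mulrA ler_wpM2l ?cabs_ge0.
  rewrite -!mulr_suml ler_wpM2r ?mulr_ge0// [leRHS](bigD1 k)//= lerDl sumr_ge0// => l _.
  apply: sumr_ge0 => i _.
  by rewrite !mulr_ge0 ?cabs_ge0 ?Ps0 ?(ltW c0)//; have [/ltW] := HC i.
rewrite (le_trans (HK u _ _ uB)) ?mulr_ge0// -!mulrA ler_wpM2l ?(ltW K0)//.
by rewrite ler_wpM2r ?mulr_ge0// lerDr.
Qed.

(** * Coordinates of points with an eventually periodic code *)

(** Clearing denominators turns a rational relation into an integral one; the dimension then makes
    the free family a basis. *)
Lemma Zbasis_basis (K : fieldExtType rat) (N n : nat) (s : N.-tuple K) (b : n.-tuple K) :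
  is_Zbasis s b -> \dim (fullv : {vspace K}) = n -> basis_of fullv b.
Proof.
move=> [_ bfree] dimK; rewrite basisEfree size_tuple dimK leqnn subvf !andbT.
apply/freeP => k k0 i.
pose D : int := \prod_j denq (k j).
have D0 : D != 0 by apply/prodf_neq0 => j _; rewrite denq_neq0.
pose m (i : 'I_n) : int := numq (k i) * \prod_(j | j != i) denq (k j).
have mE j : (m j)%:~R = D%:~R * k j.
  by rewrite /D (bigD1 j)//= /m !intrM numqE; ring.
have : \sum_(i < n) b`_i *~ m i = 0.
  rewrite -[RHS](scaler0 _ (D%:~R : rat)) -[in RHS]k0 scaler_sumr; apply: eq_bigr => j _.
  by rewrite scalerA -mE scaler_int.
move=> /bfree/(_ i) mi0; have := mE i; rewrite mi0 => /esym/eqP.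
by rewrite mulf_eq0 intr_eq0 (negPf D0) => /eqP.
Qed.

Lemma phi_linear (K : fieldExtType rat) (n : nat) (b : n.-tuple K) (a : rat) (x y : K) :
  phi b (a *: x + y) = a *: phi b x + phi b y.
Proof. by apply/matrixP => i j; rewrite !mxE linearP. Qed.

Lemma phi_inj (K : fieldExtType rat) (n : nat) (b : n.-tuple K) (x : K) :
  basis_of fullv b -> phi b x = 0 -> x = 0.
Proof.
move=> bb /matrixP x0; rewrite (coord_basis bb (memvf x)) big1// => i _.
by have := x0 i 0; rewrite !mxE => ->; rewrite scale0r.
Qed.

Lemma phi_surj (K : fieldExtType rat) (n : nat) (b : n.-tuple K) (v : 'cV[rat]_n) :
  basis_of fullv b -> exists x, phi b x = v.
Proof.
move=> bb; exists (\sum_i v i 0 *: b`_i); apply/matrixP => i j.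
by rewrite mxE ord1 coord_sum_free// (basis_free bb).
Qed.

Lemma horner_mult_matrix (K : fieldExtType rat) (n' : nat) (b : n'.+1.-tuple K)
    (A : 'M[rat]_n'.+1) (r : K) (q : {poly rat}) :
  (forall x, A *m phi b x = phi b (r * x)) ->
  forall x, horner_mx A q *m phi b x = phi b ((map_poly (in_alg K) q).[r] * x).
Proof.
move=> Ar; elim/poly_ind: q => [|q a IHq] x.
  rewrite !rmorph0 mul0mx horner0 mul0r.
  by apply/matrixP => i j; rewrite !mxE linear0.
rewrite rmorphD rmorphM/= horner_mx_X horner_mx_C mulmxDl -mulmxA Ar IHq.
rewrite mul_scalar_mx rmorphD rmorphM/= map_polyX map_polyC !hornerE/=.
rewrite addrC -phi_linear; congr (phi b _).
by rewrite mulrDl -scalerAl mul1r addrC.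
Qed.

(** In the coordinates [phi], the matrix [q(A)] is multiplication by [q(r)] in the field [K], so it
    is zero or injective. *)
Lemma mult_matrix_field (K : fieldExtType rat) (n' : nat) (b : n'.+1.-tuple K)
    (A : 'M[rat]_n'.+1) (r : K) :
  basis_of fullv b -> (forall x, A *m phi b x = phi b (r * x)) ->
  forall q : {poly rat}, horner_mx A q = 0 \/ \det (horner_mx A q) != 0.
Proof.
move=> bb Ar q; have Aq := horner_mult_matrix K n' b A r q Ar.
set M := horner_mx A q in Aq *; set z := _.[r] in Aq.
have [z0|z0] := eqVneq z 0.
  left; apply/matrixP => i j; rewrite [RHS]mxE.
  have [x xE] := phi_surj K _ b (delta_mx j 0) bb.
  have := Aq x; rewrite z0 mul0r xE -colE => /matrixP/(_ i 0).
  by rewrite !mxE linear0.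
right; rewrite -det_tr; apply/det0P => -[v v0 vM].
have [x xE] := phi_surj K _ b v^T bb.
have : M *m phi b x = 0 by rewrite xE -[M]trmxK -trmx_mul vM trmx0.
rewrite Aq => /(phi_inj K _ b _ bb)/eqP; rewrite mulf_eq0 (negPf z0)/= => /eqP x0.
move: v0; rewrite -trmx_eq0 -xE x0 => /eqP; apply.
by apply/matrixP => i j; rewrite !mxE linear0.
Qed.

(** * Itineraries of interval exchanges and the digits they produce *)

Lemma iet_left_ge0 (R : realType) (N : nat) (E : iet R N) (i : 'I_N) : 0 <= iet_left E i.
Proof. by apply: sumr_ge0 => j _; apply/ltW/iet_len_gt0. Qed.

Lemma iet_left_lt (R : realType) (N : nat) (E : iet R N) (i j : 'I_N) : (i < j)%N ->
  iet_left E i + iet_len E i <= iet_left E j.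
Proof.
move=> ij; rewrite /iet_left [leRHS](bigD1 i)//= [leRHS]addrC lerD2r.
rewrite [leLHS]big_mkcond [leRHS]big_mkcond/=; apply: ler_sum => k _.
have [ki|ik] := ltnP k i; last by case: ifP => // _; apply/ltW/iet_len_gt0.
by rewrite (ltn_trans ki ij) -val_eqE/= ltn_eqF.
Qed.

Lemma iet_right_le1 (R : realType) (N : nat) (E : iet R N) (i : 'I_N) :
  iet_left E i + iet_len E i <= 1.
Proof.
rewrite -(iet_len_sum E) [leRHS](bigD1 i)//= [leRHS]addrC lerD2r /iet_left.
rewrite [leLHS]big_mkcond [leRHS]big_mkcond/=; apply: ler_sum => k _.
have [ki|ik] := ltnP k i; last by case: ifP => // _; apply/ltW/iet_len_gt0.
by rewrite -val_eqE/= ltn_eqF.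
Qed.

Lemma in_piece_itv (R : realType) (N : nat) (E : iet R N) (i : 'I_N) (x : R) :
  in_piece E i x -> 0 <= x < 1.
Proof.
move=> /andP[lx xr]; rewrite (le_trans (iet_left_ge0 _ _ _ _) lx)/=.
by rewrite (lt_le_trans xr)// iet_right_le1.
Qed.

Lemma in_piece_uniq (R : realType) (N : nat) (E : iet R N) (i j : 'I_N) (x : R) :
  in_piece E i x -> in_piece E j x -> i = j.
Proof.
move=> /andP[ix xi] /andP[jx xj]; apply/val_inj/eqP; case: ltngtP => // ij.
- by have := lt_le_trans xi (le_trans (iet_left_lt _ _ _ _ _ ij) jx); rewrite ltxx.
- by have := lt_le_trans xj (le_trans (iet_left_lt _ _ _ _ _ ij) ix); rewrite ltxx.
Qed.

Lemma iet_mapE (R : realType) (N : nat) (E : iet R N) (i : 'I_N) (x : R) :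
  in_piece E i x -> iet_map E x = x + iet_trans E i.
Proof.
move=> ix; rewrite /iet_map; case: pickP => [j jx|/(_ i)]; last by rewrite ix.
by rewrite (in_piece_uniq _ _ _ _ _ _ ix jx).
Qed.

(** Generic in [V], so that the same formula serves for the real translations and for their lifts to
    [K]. *)
Definition digit (V : zmodType) (N : nat) (tau : 'I_N -> V)
    (sigma : 'I_N -> seq 'I_N) (i : 'I_N) (m : nat) : V :=
  \sum_(k < m) tau (nth i (sigma i) k).

Lemma iter_digit (R : realType) (N : nat) (E : iet R N) (rho : R)
    (sigma : 'I_N -> seq 'I_N) (i : 'I_N) (x : R) (m : nat) :
  is_substitution E rho sigma -> in_piece E i x -> (m <= size (sigma i))%N ->
  iter m (iet_map E) (rho * x) = rho * x + digit R N (iet_trans E) sigma i m.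
Proof.
move=> hs ix; have [_ piece] := hs i x ix; rewrite /digit.
elim: m => [|m IHm] ms; first by rewrite big_ord0 addr0.
rewrite iterS (iet_mapE _ _ _ _ _ (piece m ms)) IHm ?(ltnW ms)//.
by rewrite big_ord_recr/= [RHS]addrA.
Qed.

(** Iteration gives [f 0 = rho^m f m], which tends to zero. Applied to the difference of two
    sequences of points with the same code, it shows that the code determines the point. *)
Lemma contraction_fixed (R : realType) (rho : R) (f : nat -> R) :
  0 < rho < 1 -> (forall k, f k = rho * f k.+1) -> (forall k, `|f k| <= 1) -> f 0%N = 0.
Proof.
move=> /andP[r0 r1] fE f1; apply/eqP; apply: contraTT isT => f0; exfalso.
have rV1 : 1 < rho^-1 by rewrite invf_gt1.
have [h _ hr] := exists_exp_ge2 R _ rV1.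
have fX m : f 0%N = rho ^+ m * f m.
  by elim: m => [|m IHm]; rewrite ?mul1r// IHm fE exprSr mulrA.
have fp : 0 < `|f 0%N| by rewrite normr_gt0.
have [m mE] := two_exp_bound R (2 / `|f 0%N|).
have : (rho^-1) ^+ (h * m) <= `|f 0%N|^-1.
  rewrite exprVn lef_pV2 ?posrE ?exprn_gt0// {1}(fX (h * m)%N) normrM.
  by rewrite ger0_norm ?exprn_ge0 ?(ltW r0)// ler_piMr ?exprn_ge0 ?(ltW r0).
have : 2 ^+ m <= (rho^-1) ^+ (h * m).
  by rewrite exprM lerXn2r ?nnegrE// exprn_ge0// invr_ge0 ltW.
have : 0 < `|f 0%N|^-1 by rewrite invr_gt0.
lra.
Qed.

(** [rho] lies in the image of [K], being the quotient of [rho |Omega_i|] by [|Omega_i|]. The matrix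
    identity, given on the module, extends to [K] by linearity because [b] is also a rational
    basis. *)
Lemma mult_matrix_generator (R : realType) (K : fieldExtType rat)
    (iota : {rmorphism K -> R}) (N n' : nat) (E : iet R N) (len : N.-tuple K)
    (b : n'.+1.-tuple K) (rho : R) (A : 'M[int]_n'.+1) :
  (1 < N)%N -> (forall i, iota (tnth len i) = iet_len E i) ->
  is_Zbasis len b -> basis_of fullv b -> is_mult_matrix iota len b rho A ->
  exists r : K, iota r = rho /\
    forall x, (map_mx intr A : 'M[rat]_n'.+1) *m phi b x = phi b (r * x).
Proof.
move=> hN hlen [spanE _] bb hA; pose i0 := Ordinal (ltnW hN : 0 < N)%N.
have span1 (m : nat) (s : m.-tuple K) (i : 'I_m) : inIntSpan s (tnth s i).
  exists [ffun j => (j == i)%:Z]; rewrite (bigD1 i)//= ffunE eqxx mulr1z.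
  rewrite big1 ?addr0 ?(tnth_nth 0)// => j ji.
  by rewrite ffunE (negPf ji) mulr0z.
have len0 : tnth len i0 != 0.
  apply/eqP => l0; have := iet_len_gt0 E i0; rewrite -hlen l0 rmorph0 ltxx.
  by [].
have [y yE _] := hA _ (span1 _ len i0).
pose r := y / tnth len i0; exists r.
have rE : iota r = rho.
  by rewrite rmorphM fmorphV yE mulfK// fmorph_eq0.
split=> // x.
have Ab (i : 'I_n'.+1) : (map_mx intr A : 'M[rat]_n'.+1) *m phi b b`_i = phi b (r * b`_i).
  have bspan : inIntSpan len b`_i by apply/spanE; rewrite -(tnth_nth 0).
  have [z zE ->] := hA _ bspan; congr (phi b _).
  by apply: (fmorph_inj iota); rewrite zE rmorphM rE.
have phi0 : phi b 0 = 0 by apply/matrixP => i j; rewrite !mxE linear0.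
have phiD y' z' : phi b (y' + z') = phi b y' + phi b z'.
  by rewrite -[y']scale1r phi_linear !scale1r.
have phiZ a y' : phi b (a *: y') = a *: phi b y'.
  by rewrite -[a *: y']addr0 phi_linear phi0 addr0.
rewrite (coord_basis bb (memvf x)) mulr_sumr.
rewrite !(big_morph (phi b) phiD phi0) mulmx_sumr; apply: eq_bigr => i _.
by rewrite -scalerAr !phiZ -scalemxAr Ab.
Qed.

(** Applied to [phi b 1], equal powers of [A] would give equal powers of [rho], although
    [0 < rho < 1]. *)
Lemma mult_matrix_pow_inj (R : realType) (K : fieldExtType rat)
    (iota : {rmorphism K -> R}) (n' : nat) (b : n'.+1.-tuple K) (rho : R) (r : K)
    (A : 'M[int]_n'.+1) :
  0 < rho /\ rho < 1 -> basis_of fullv b -> iota r = rho ->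
  (forall x, (map_mx intr A : 'M[rat]_n'.+1) *m phi b x = phi b (r * x)) ->
  forall i j, (i < j)%N -> A ^+ i != A ^+ j.
Proof.
move=> [rho0 rho1] bb rE Ar i j ij; apply/eqP => AX.
have AXr m x : map_mx intr (A ^+ m) *m phi b x = phi b (r ^+ m * x).
  rewrite (rmorphXn (map_mx (intr : int -> rat)) m A).
  elim: m => [|m IHm]; first by rewrite mul1mx mul1r.
  by rewrite exprS -mulmxA IHm Ar exprS mulrA.
have : phi b (r ^+ i - r ^+ j) = 0.
  have := AXr j 1; rewrite -AX AXr !mulr1 => E.
  by rewrite addrC -scaleN1r phi_linear E scaleN1r addNr.
move=> /(phi_inj _ _ _ _ bb)/(congr1 iota)/eqP.
rewrite rmorphB !rmorphXn rmorph0 rE subr_eq0 gt_eqF//.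
by rewrite ltr_iXn2l.
Qed.

Theorem proposition9 (R : realType) (N : nat) (hN : (1 < N)%N)
  (E : iet R N) (hirr : iet_irreducible E) (hue : uniquely_ergodic E)
  (K : fieldExtType rat) (iota : {rmorphism K -> R})
  (len : N.-tuple K) (hlen : forall i : 'I_N, iota (tnth len i) = iet_len E i)
  (hK : <<1 & len>>%VS = fullv)
  (n : nat) (hn : \dim (fullv : {vspace K}) = n)
  (b : n.-tuple K) (hb : is_Zbasis len b)
  (rho : R) (hrho : renormalizable E rho)
  (sigma : 'I_N -> seq 'I_N) (hsigma : is_substitution E rho sigma)
  (A : 'M[int]_n) (hA : is_mult_matrix iota len b rho A)
  (nrm : 'cV[R]_n -> R) (hnrm : is_vnorm nrm) :
  exists2 C : R, 0 < C &
    forall (x : R) (c : nat -> 'I_N * seq 'I_N) (t T : nat),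
      0 <= x < 1 ->
      vershik_code E rho sigma x c ->
      eventually_periodic c t T ->
      exists2 z : K, iota z = x &
        nrm (map_mx ratr (phi b z))
          <= C * op_norm nrm (map_mx intr A) ^+ (t + T).
Proof.
have bb := Zbasis_basis K N n len b hb hn.
case: n hn b hb bb A hA nrm hnrm => [|n'] hn b hb bb A hA nrm hnrm.
  by have := adim_gt0 {:K}%AS; rewrite hn.
have [/andP[rho0 rho1] _] := hrho.
pose AQ : 'M[rat]_n'.+1 := map_mx intr A.
pose AR : 'M[R]_n'.+1 := map_mx intr A.
have [rhoK [rhoKE ArhoK]] := mult_matrix_generator R K iota N n' E len b rho A hN hlen hb bb hA.
have alt := mult_matrix_field K n' b AQ rhoK bb ArhoK.
have Ainj := mult_matrix_pow_inj R K iota n' b rho rhoK A (conj rho0 rho1) bb rhoKE ArhoK.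
pose Lam := op_norm nrm AR.
have Lam1 : 1 < Lam := op_norm_gt1 R n' A nrm hnrm Ainj.
have [C C0 HC] := periodic_point_bound R n' A nrm Lam alt Ainj hnrm Lam1.
pose phiR (z : K) : 'cV[R]_n'.+1 := map_mx ratr (phi b z).
have phiRD y z : phiR (y + z) = phiR y + phiR z.
  by rewrite /phiR -[y]scale1r phi_linear !scale1r map_mxD.
have phiR0 : phiR 0 = 0.
  by apply/matrixP => i j; rewrite !mxE linear0 rmorph0.
have phiR_sum m (F : 'I_m -> K) : phiR (\sum_(j < m) F j) = \sum_(j < m) phiR (F j).
  exact: (big_morph phiR phiRD phiR0).
have phiRM z : AR *m phiR z = phiR (rhoK * z).
  rewrite /phiR -ArhoK map_mxM; congr (_ *m _).
  by apply/matrixP => i j; rewrite !mxE rmorph_int.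
have phiRX j z : AR ^+ j *m phiR z = phiR (rhoK ^+ j * z).
  elim: j => [|j IHj]; first by rewrite mul1mx mul1r.
  by rewrite exprS -mulmxA IHj phiRM exprS mulrA.
pose tauK (i : 'I_N) : K :=
  \sum_(j < N | (iet_perm E j < iet_perm E i)%N) tnth len j
  - \sum_(j < N | (j < i)%N) tnth len j.
have tauKE i : iota (tauK i) = iet_trans E i.
  by rewrite rmorphB !rmorph_sum; congr (_ - _); apply: eq_bigr => j _; apply: hlen.
pose dig := digit K N tauK sigma.
have digE i m : iota (dig i m) = digit R N (iet_trans E) sigma i m.
  by rewrite rmorph_sum; apply: eq_bigr => j _; apply: tauKE.
(* A bound for all digits, finite in number since each letter has finitely many prefixes. *)
pose B := \sum_i \sum_(m < (size (sigma i)).+1) nrm (phiR (dig i m)).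
have digB i m : (m <= size (sigma i))%N -> nrm (phiR (dig i m)) <= B.
  move=> ms; rewrite /B (bigD1 i)//= (bigD1 (Ordinal (ms : m < _.+1)%N))//=.
  rewrite -addrA lerDl addr_ge0// ?sumr_ge0// => [j _|j _].
    exact: vnorm_ge0.
  by apply: sumr_ge0 => k _; apply: vnorm_ge0.
have B0 : 0 <= B.
  by apply: sumr_ge0 => i _; apply: sumr_ge0 => k _; apply: vnorm_ge0.
(* The geometric sum over the transient gives [B / (Lam - 1)], the periodic part gives [C * B], and
   the summand 1 keeps the constant positive when [B = 0]. *)
exists (B / (Lam - 1) + C * B + 1) => [|x c t T x01 [y y0 hy] [T0 per]].
  rewrite ltr_wpDl// addr_ge0 ?mulr_ge0 ?invr_ge0 ?(ltW C0)//; lra.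
pose dc k := dig (c k).1 (size (c k).2).
have dcB k : nrm (phiR (dc k)) <= B.
  by apply: digB; have [/andP[/size_prefix]] := hy k.
have yE k : y k = rho * y k.+1 + iota (dc k).
  have [/andP[/size_prefix sz _] piece ->] := hy k.
  by rewrite (iter_digit _ _ _ _ _ _ _ _ hsigma piece sz) digE.
have y01 k : 0 <= y k < 1.
  by case: k => [|k]; [rewrite y0 | have [_ /in_piece_itv] := hy k].
(* From time [t] on, both sequences use the same digits, so their difference satisfies the
   homogeneous recursion and stays bounded by 1. *)
have yper : y t = y (t + T)%N.
  apply/eqP; rewrite -subr_eq0; apply/eqP.
  have := contraction_fixed R rho (fun k => y (t + k)%N - y (t + k + T)%N).
  rewrite addn0; apply=> [|k|k]; first by rewrite rho0.
    rewrite yE [y (t + k + T)%N]yE /dc per ?leq_addr// addnS addSn.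
    by rewrite opprD addrACA subrr addr0 mulrBr.
  have := y01 (t + k)%N; have := y01 (t + k + T)%N.
  move=> /andP[a1 a2] /andP[a3 a4]; rewrite ler_norml; apply/andP; split; lra.
have yX a m : y a = iota (\sum_(j < m) rhoK ^+ j * dc (a + j)%N) + rho ^+ m * y (a + m)%N.
  elim: m => [|m IHm]; first by rewrite big_ord0 rmorph0 add0r mul1r addn0.
  rewrite IHm big_ord_recr/= rmorphD rmorphM rmorphXn rhoKE -addrA; congr (_ + _).
  by rewrite yE addnS exprSr mulrDr mulrA addrC.
pose s := \sum_(j < T) rhoK ^+ j * dc (t + j)%N.
have rT : rho ^+ T < 1 by rewrite exprn_ilt1// ?ltW// -lt0n.
have r1 : 1 - rhoK ^+ T != 0.
  apply/eqP => /(congr1 iota); rewrite rmorphB rmorph1 rmorphXn rhoKE rmorph0.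
  by move/eqP; rewrite subr_eq0 gt_eqF.
(* The periodic equation is solved inside [K]; uniqueness of its real solution identifies [zt] with
   [y t]. *)
have [zt ztE] : exists zt, zt - rhoK ^+ T * zt = s.
  by exists (s / (1 - rhoK ^+ T)); rewrite -[X in X - _]mul1r -mulrBl mulrC divfK.
have yt : iota zt = y t.
  have := yX t T; rewrite -yper -/s -ztE rmorphB rmorphM rmorphXn rhoKE => H.
  have : (1 - rho ^+ T) * (y t - iota zt) = 0 by lra.
  by move/eqP; rewrite mulf_eq0 subr_eq0 gt_eqF//= subr_eq0 => /eqP.
exists (\sum_(j < t) rhoK ^+ j * dc (0 + j)%N + rhoK ^+ t * zt).
  have zE S : iota (S + rhoK ^+ t * zt) = iota S + rho ^+ t * y t.
    by rewrite rmorphD [iota (_ * zt)]rmorphM [iota (rhoK ^+ t)]rmorphXn rhoKE yt.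
  by rewrite zE -y0 (yX 0%N t) add0n.
have ztB : nrm (phiR zt) <= C * B * Lam ^+ T.
  apply: (HC T _ (fun j => phiR (dc (t + j)%N)) B T0 B0) => [j|]; first exact: dcB.
  rewrite -/AR phiRX.
  have -> : phiR zt - phiR (rhoK ^+ T * zt) = phiR s.
    have -> : phiR zt = phiR s + phiR (rhoK ^+ T * zt) by rewrite -phiRD -ztE subrK.
    by rewrite addrK.
  by rewrite /s phiR_sum; apply: eq_bigr => j _; rewrite -/AR phiRX.
have LamX (m : nat) : 1 <= Lam ^+ m by rewrite exprn_ege1// ltW.
have powB j z : nrm (phiR (rhoK ^+ j * z)) <= Lam ^+ j * nrm (phiR z).
  rewrite -phiRX; have -> : AR ^+ j *m phiR z = iter j (mulmx AR) (phiR z).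
    by elim: j => [|j IHj]; rewrite ?mul1mx// exprS -mulmxA IHj.
  exact: op_norm_powM.
rewrite -/(phiR _) -/AR -/Lam phiRD; have [nD _ _] := hnrm.
rewrite (le_trans (nD _ _))// phiR_sum.
apply: (@le_trans _ _ (B / (Lam - 1) * Lam ^+ t + C * B * (Lam ^+ t * Lam ^+ T))).
  apply: lerD.
    apply: (@le_trans _ _ (\sum_(j < t) Lam ^+ j * B)).
      rewrite (le_trans (vnorm_sum _ _ _ _ _ _ _ hnrm))//; apply: ler_sum => j _.
      rewrite (le_trans (powB _ _))// ler_wpM2l// exprn_ge0//; lra.
    rewrite -mulr_suml mulrAC [B * _]mulrC -mulrA [B / _]mulrC mulrA ler_wpM2r//.
    rewrite ler_pdivlMr; last lra.
    by rewrite mulrC -subrX1 gerBl.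
  rewrite (le_trans (powB _ _))// mulrCA ler_wpM2l// exprn_ge0//; lra.
have -> : (B / (Lam - 1) + C * B + 1) * Lam ^+ (t + T)
   = B / (Lam - 1) * Lam ^+ (t + T) + C * B * (Lam ^+ t * Lam ^+ T) + Lam ^+ (t + T).
  by rewrite exprD; ring.
have H1 : B / (Lam - 1) * Lam ^+ t <= B / (Lam - 1) * Lam ^+ (t + T).
  rewrite ler_wpM2l ?divr_ge0//; first lra.
  by rewrite ler_weXn2l ?leq_addr// ltW.
have := LamX (t + T)%N; lra.
Qed.
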